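(* Let $r$ be a prime power and let $k,N,j,d$ be positive integers satisfying $(k+1)r+r-1\le (N+1)(j-1)$ and $(r-1)(d+1)+1\le r(k+1)$. Then for every continuous map $f:\Delta^N\to\mathbb{R}^d$ there exist $r$ faces $\sigma_1,\dots,\sigma_r$ of the $N$-dimensional simplex $\Delta^N$, each of dimension at most $k$, which are $j$-wise disjoint, such that $f(\sigma_1)\cap\dots\cap f(\sigma_r)\neq\emptyset$.
   Context: Faces $\sigma_1,\dots,\sigma_r$ (identified with their vertex sets) are $j$-wise disjoint if any $j$ of them, $\sigma_{t_1},\dots,\sigma_{t_j}$ with $t_1<\dots<t_j$, have no common vertex. *)

(* Defs.v *)
From HB Require Import structures.
From mathcomp Require Import all_boot all_order all_algebra.
From mathcomp Require Import all_classical all_reals all_analysis.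
Set Implicit Arguments. Unset Strict Implicit. Unset Printing Implicit Defensive.
Import Order.TTheory GRing.Theory Num.Theory.
Import numFieldTopology.Exports numFieldNormedType.Exports.
Local Open Scope classical_set_scope.
Local Open Scope ring_scope.

Definition prime_power (r : nat) : Prop :=
  exists p e : nat, [/\ prime p, (0 < e)%N & r = (p ^ e)%N].

Definition simplex (R : realType) (N : nat) : set 'rV[R]_(N.+1) :=
  [set x | (forall i, 0 <= x ord0 i) /\ \sum_(i < N.+1) x ord0 i = 1].
Arguments simplex : clear implicits.

(* The geometric face spanned by the vertex set s : points of the simplex
   supported on s (= convex hull of the vertices in s). *)
Definition face_pts (R : realType) (N : nat) (s : {set 'I_(N.+1)})
  : set 'rV[R]_(N.+1) :=
  [set x | simplex R N x /\ forall i, i \notin s -> x ord0 i = 0].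

Definition jwise_disjoint (N r j : nat) (sigma : 'I_r -> {set 'I_(N.+1)}) : Prop :=
  forall T : {set 'I_r}, #|T| = j ->
    forall v : 'I_(N.+1), exists2 t, t \in T & v \notin sigma t.

(* Main.v *)
(** Each vertex of the simplex is repeated [j - 1] times: pairwise disjoint faces
    of the blown-up simplex project to [j]-wise disjoint faces, so it is enough
    to treat [j = 2].  Adjoining the elementary symmetric polynomial of degree
    [k + 2] in the barycentric coordinates, which vanishes exactly on the
    [k]-skeleton, as one more coordinate function, the dimension bound follows by
    counting vertices from the topological Tverberg theorem for prime powers.

    That theorem reduces, in the style of Sperner's lemma, to a statement on
    labellings of the deleted join [D] of [r] simplices, which is acyclic below
    its dimension [n] and carries a free action of [G = (Z/p)^e]: an equivariant
    labelling by pairs (coordinate, element of [G]) cannot avoid, on all small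
    simplices, having all of [G] as labels in one coordinate.  Otherwise it would
    give an equivariant chain map from [D] to a complex [Y] of dimension [n - 1]
    without [G]-fixed simplices.  Over [F_p(X)] the group algebra contains a
    generic nilpotent element [T] with [T^p = 0] (a shifted cyclic subgroup),
    for which [ker T = im T^(p-1)] and [ker T^(p-1) = im T] on the cochains of
    [Y].  Starting from the unit cochain one thus finds cochains [z_i] of [Y] with
    [d z_(i-1) = T z_i] or [T^(p-1) z_i] alternately; pulled back to [D] and
    evaluated on a truncated resolution of the trivial module, [T^(p-1) z_i] has
    value 1 for every [i <= n], although [z_n = 0]. *)

Require Import Defs.
From HB Require Import structures.
From mathcomp Require Import all_boot all_order all_algebra.
From mathcomp Require Import all_classical all_reals all_analysis.
From mathcomp Require Import zify lra.
Set Implicit Arguments. Unset Strict Implicit. Unset Printing Implicit Defensive.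
Import Order.TTheory GRing.Theory Num.Theory.
Import numFieldTopology.Exports numFieldNormedType.Exports.
Local Open Scope ring_scope.

(** * Nilpotent operators in characteristic p *)

Section IterFrobenius.
Variable V : zmodType.
Implicit Types (A B : V -> V) (v : V).

Definition additive_op A := forall v w, A (v + w) = A v + A w.

Lemma additive_op0 A : additive_op A -> A 0 = 0.
Proof. by move=> hA; apply: (@addIr _ (A 0)); rewrite -hA !add0r. Qed.

Lemma additive_op_sum A (I : Type) (s : seq I) (P : pred I) (F : I -> V) :
  additive_op A -> A (\sum_(i <- s | P i) F i) = \sum_(i <- s | P i) A (F i).
Proof. by move=> hA; apply: (big_morph A hA (additive_op0 hA)). Qed.

Lemma additive_opMn A v n : additive_op A -> A (v *+ n) = A v *+ n.
Proof.
by move=> hA; elim: n => [|n IH]; rewrite ?mulr0n ?additive_op0 // !mulrS hA IH.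
Qed.

Lemma additive_op_iter A n : additive_op A -> additive_op (iter n A).
Proof. by move=> hA v w; elim: n => //= n ->; rewrite hA. Qed.

Lemma iter_comm A B n v : (forall v, A (B v) = B (A v)) ->
  A (iter n B v) = iter n B (A v).
Proof. by move=> hAB; elim: n => //= n IH; rewrite hAB IH. Qed.

Lemma iter_addop A B n v :
  additive_op A -> additive_op B -> (forall v, A (B v) = B (A v)) ->
  iter n (fun v => A v + B v) v =
  \sum_(k < n.+1) iter (n - k) A (iter k B v) *+ 'C(n, k).
Proof.
move=> hA hB hAB; elim: n => [|n IH]; first by rewrite big_ord1.
rewrite iterS IH (additive_op_sum _ _ _ hA) (additive_op_sum _ _ _ hB).
rewrite big_ord_recl [in RHS]big_ord_recl /= !subn0 !bin0 -addrA; congr (_ + _).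
rewrite [X in X + _](_ : _ =
   \sum_(i < n.+1) iter (n - i) A (iter i.+1 B v) *+ 'C(n, i.+1)); last first.
  rewrite [RHS]big_ord_recr /= bin_small // mulr0n addr0; apply: eq_bigr => i _.
  by rewrite additive_opMn //= /bump /= add0n -[in RHS]subSS (subSn (ltn_ord i)).
rewrite -big_split /=; apply: eq_bigr => i _.
rewrite additive_opMn // /bump /= add0n add1n subSS binS mulrnDr; congr (_ + _).
congr (_ *+ _); rewrite (iter_comm (n - i) _ (fun w => esym (hAB w))).
by [].
Qed.

(** Binomial expansion for commuting operators: [p] divides every inner binomial coefficient. *)
Lemma iter_frobenius p A B v :
  prime p -> (forall w : V, w *+ p = 0) ->
  additive_op A -> additive_op B -> (forall v, A (B v) = B (A v)) ->
  iter p (fun v => A v + B v) v = iter p A v + iter p B v.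
Proof.
move=> pp pV hA hB hAB; rewrite iter_addop //.
case: p pp pV => // q pp pV; rewrite big_ord_recl big_ord_recr /=.
rewrite /bump /= !add0n !add1n subnn bin0 binn !mulr1n big1 ?add0r //.
move=> [i hi] _ /=.
have /dvdnP[k ->] : (q.+1 %| 'C(q.+1, 1 + (0 + i)))%N.
  by rewrite prime_dvd_bin.
by rewrite mulrnA pV.
Qed.

Lemma iter_frobenius_sum (I : Type) (s : seq I) p (P : I -> V -> V) v :
  prime p -> (forall w : V, w *+ p = 0) ->
  (forall i, additive_op (P i)) -> (forall i j v, P i (P j v) = P j (P i v)) ->
  iter p (fun v => \sum_(i <- s) P i v) v = \sum_(i <- s) iter p (P i) v.
Proof.
move=> pp pV hP hPP; elim: s => [|i s IH].
  rewrite big_nil; case: p pp {pV} => // p _ /=; by rewrite big_nil.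
rewrite big_cons -IH -iter_frobenius //.
- congr (iter p _ v); apply: funext => w; by rewrite big_cons.
- by move=> w w'; rewrite -big_split; apply: eq_bigr => j _; apply: hP.
- move=> w; rewrite (additive_op_sum _ _ _ (hP i)); by apply: eq_bigr.
Qed.

End IterFrobenius.

(* In characteristic p, the Weyl relation TU - UT = 1 makes the complex with
   alternating differentials T and T^(p-1) exact. *)
Section Weyl.
Variables (K : fieldType) (V : lmodType K) (p : nat).
Hypotheses (p_prime : prime p) (charK : p \in [pchar K]).
Variables (Q : V -> Prop) (T U : V -> V).
Hypotheses (T_add : additive_op T) (TZ : forall k v, T (k *: v) = k *: T v).
Hypothesis U0 : U 0 = 0.
Hypotheses (QT : forall v, Q v -> Q (T v)) (QU : forall v, Q v -> Q (U v)).
Hypotheses (QD : forall v w, Q v -> Q w -> Q (v + w)).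
Hypotheses (QZ : forall k v, Q v -> Q (k *: v)).
Hypothesis TU : forall v, Q v -> T (U v) = U (T v) + v.

Lemma iter_opZ n k v : iter n T (k *: v) = k *: iter n T v.
Proof. by elim: n => //= n ->; rewrite TZ. Qed.

Lemma iterTU n v : Q v ->
  iter n.+1 T (U v) = U (iter n.+1 T v) + iter n T v *+ n.+1.
Proof.
move=> Qv; elim: n => [|n IH]; first by rewrite /= TU // mulr1n.
rewrite iterS IH T_add TU; last by elim: (n.+1) => //= m; apply: QT.
by rewrite additive_opMn // -addrA -mulrS.
Qed.

Lemma natf_unit n : (0 < n < p)%N -> n%:R != 0 :> K.
Proof.
move=> /andP[n0 np]; rewrite -(dvdn_pcharf charK).
by apply/negP => /(dvdn_leq n0); rewrite leqNgt np.
Qed.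

Lemma fact_unit n : (n < p)%N -> n`!%:R != 0 :> K.
Proof.
elim: n => [|n IH] np; first by rewrite oner_eq0.
by rewrite factS natrM mulf_neq0 ?IH ?natf_unit // ltnW.
Qed.

(** When [T v = 0], the commutation relation gives [T^n U^n v = n! v] by induction, and [(p-1)!] is
    invertible in [K]. *)
Lemma ker_sub_im_iter v : Q v -> T v = 0 -> exists2 w, Q w & v = iter p.-1 T w.
Proof.
move=> Qv Tv0.
have QUn n : Q (iter n U v) by elim: n => //= n; apply: QU.
have key n : iter n T (iter n U v) = v *+ n`!.
  elim: n => [|n IH]; first by rewrite mulr1n.
  rewrite [in X in iter _ T X]iterS iterTU // IH.
  have -> : iter n.+1 T (iter n U v) = 0.
    by rewrite iterS IH additive_opMn // Tv0 mul0rn.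
  by rewrite U0 add0r -mulrnA factS mulnC.
exists ((p.-1)`!%:R^-1 *: iter p.-1 U v); first exact: QZ.
rewrite iter_opZ key -scaler_nat scalerA mulVf ?scale1r //.
by rewrite fact_unit // prednK ?prime_gt0.
Qed.

(** Descent on the exponent: if [T^(k+1) v = 0], then [T^(k+1) U v = (k+1) T^k v], so subtracting
    [T (U v / (k+1))] from [v] gives an element killed by [T^k]. *)
Lemma ker_iter_sub_im v : Q v -> iter p.-1 T v = 0 -> exists2 w, Q w & v = T w.
Proof.
move: {-2}p.-1 (leqnn p.-1) => k; elim: k v => [|k IH] v kp Qv.
  by move=> /= ->; exists 0; [rewrite -(scale0r v); apply: QZ|rewrite additive_op0].
move=> Tk0.
have k0 : k.+1%:R != 0 :> K.
  by rewrite natf_unit //= -ltn_predRL.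
pose w := k.+1%:R^-1 *: U v.
have Qw : Q w by apply/QZ/QU.
have [||w' Qw' h] := IH (v - T w) (ltnW kp).
- by apply: QD => //; rewrite -scaleN1r; apply/QZ/QT.
- rewrite -scaleN1r (additive_op_iter _ T_add) iter_opZ -iterSr iter_opZ iterTU //.
  by rewrite Tk0 U0 add0r -scaler_nat !scalerA -mulrA mulVf // mulr1 scaleN1r subrr.
exists (w' + w); first exact: QD.
by rewrite T_add -h subrK.
Qed.

End Weyl.

(** * Cochains on finite sequences *)

(* Cochains take values in [K^o], the field viewed as a module over itself, so
   that they form an [lmodType K]. *)
Section Coboundary.
Variables (K : fieldType) (X : Type).
Implicit Types (phi psi : seq X -> K^o) (s t : seq X).

(** The transpose of the boundary [d (x t) = t - x (d t)] of ordered simplices, degenerate ones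
    included. The empty sequence plays the role of the augmentation degree. *)
Fixpoint cobd phi s : K^o :=
  if s is x :: t then phi t - cobd (fun t => phi (x :: t)) t else 0.

Lemma cobd0 s : cobd (fun=> 0) s = 0.
Proof. by elim: s => //= x s ->; rewrite subrr. Qed.

Lemma cobdD phi psi s : cobd (phi + psi) s = cobd phi s + cobd psi s.
Proof.
elim: s phi psi => [|x s IH] phi psi /=; first by rewrite addr0.
have -> : (fun t => (phi + psi) (x :: t)) =
   (fun t => phi (x :: t)) + (fun t => psi (x :: t)) by [].
by rewrite IH opprD addrACA.
Qed.

Lemma cobdZ k phi s : cobd (k *: phi) s = k * cobd phi s.
Proof.
elim: s phi => [|x s IH] phi /=; first by rewrite mulr0.
have -> : (fun t => (k *: phi) (x :: t)) = k *: (fun t => phi (x :: t)) by [].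
by rewrite IH mulrBr.
Qed.

Lemma cobdB phi psi s : cobd (phi - psi) s = cobd phi s - cobd psi s.
Proof. by rewrite -scaleN1r cobdD cobdZ mulN1r. Qed.

Lemma cobd_cobd phi s : cobd (cobd phi) s = 0.
Proof.
elim: s phi => [|x s IH] phi //=.
have -> : (fun t => phi t - cobd (fun t => phi (x :: t)) t) =
  phi - cobd (fun t => phi (x :: t)) by [].
by rewrite cobdB IH subr0 subrr.
Qed.

End Coboundary.

Lemma cobd_eq (K : fieldType) (X : eqType) (phi psi : seq X -> K^o) s :
  (forall t, {subset t <= s} -> (size t).+1 = size s -> phi t = psi t) ->
  cobd phi s = cobd psi s.
Proof.
elim: s phi psi => [|x s IH] phi psi //= h.
rewrite h //; last by move=> y ys; rewrite inE ys orbT.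
congr (_ - _); apply: IH => t ts st; apply: h; last by rewrite /= st.
by move=> y; rewrite !inE => /predU1P[->|/ts ->]; rewrite ?eqxx ?orbT.
Qed.

Lemma cobd_map (K : fieldType) (X Y : Type) (f : X -> Y) (phi : seq Y -> K^o) s :
  cobd (fun t => phi (map f t)) s = cobd phi (map f s).
Proof.
elim: s phi => [|x s IH] phi //=.
by rewrite -(IH (fun t => phi (f x :: t))).
Qed.

Section Alternating.
Variables (K : fieldType) (X : eqType).
Implicit Types (phi psi : seq X -> K^o) (s t : seq X).

(** Vanishing on repetitions is a separate clause because the sign rule does not imply it in
    characteristic 2. *)
Definition alt_cochain phi :=
  (forall s a b t, phi (s ++ a :: b :: t) = - phi (s ++ b :: a :: t)) /\
  (forall s a t, phi (s ++ a :: a :: t) = 0).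

Lemma alt_cochain_cons phi x :
  alt_cochain phi -> alt_cochain (fun t => phi (x :: t)).
Proof.
by case=> h1 h2; split=> [s a b t|s a t]; [exact: (h1 (x :: s))|exact: (h2 (x :: s))].
Qed.

Lemma alt_cochain_cobd phi : alt_cochain phi -> alt_cochain (cobd phi).
Proof.
move=> h; split=> s.
  elim: s phi h => [|x s IH] phi h a b t /=; last first.
    by rewrite h.1 (IH _ (alt_cochain_cons x h)) opprB opprK addrC.
  have -> : (fun t => phi (a :: b :: t)) = (-1) *: (fun t => phi (b :: a :: t)).
    by apply: funext => u; rewrite scaleN1r; apply: (h.1 [::]).
  by rewrite cobdZ mulN1r !opprB addrA.
elim: s phi h => [|x s IH] phi h a t /=; last first.
  by rewrite h.2 (IH _ (alt_cochain_cons x h)) subr0.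
have -> : (fun t => phi (a :: a :: t)) = fun=> 0.
  by apply: funext => u; apply: (h.2 [::]).
by rewrite cobd0 subr0 subrr.
Qed.

Lemma alt_cochain_non_uniq phi s : alt_cochain phi -> ~~ uniq s -> phi s = 0.
Proof.
move=> h; elim: s phi h => [|x s IH] phi h //=; rewrite negb_and negbK.
case/orP => [xs|]; last exact: (IH _ (alt_cochain_cons x h)).
case/splitPr: xs => s1 s2.
elim: s1 phi h {IH} => [|y s1 IH] phi h /=; first exact: (h.2 [::]).
by rewrite (h.1 [::]) /= (IH _ (alt_cochain_cons y h)) oppr0.
Qed.

End Alternating.

Section Shift.
Variables (K : fieldType) (X : Type) (G : finZmodType) (act : G -> X -> X).
Hypothesis act0 : forall x, act 0 x = x.
Hypothesis actD : forall g h x, act (g + h) x = act g (act h x).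
Implicit Types (phi psi : seq X -> K^o) (s t : seq X) (b : G -> seq X -> K).

(** The action of the group algebra element with coefficients [b]. These may vary with [s]; when
    they are constant on orbits, two such operators still commute. *)
Definition shift_sum b phi s : K^o := \sum_g b g s * phi (map (act g) s).

Definition shift_invariant b :=
  forall g h s, b g (map (act h) s) = b g s.

Lemma map_act0 s : map (act 0) s = s.
Proof. by rewrite (eq_map act0) map_id. Qed.

Lemma map_actD g h s : map (act (g + h)) s = map (act g) (map (act h) s).
Proof. by rewrite -map_comp; apply: eq_map => x; rewrite actD. Qed.

Lemma shift_sumD b : additive_op (shift_sum b).
Proof.
move=> phi psi; apply: funext => s; change (shift_sum b (phi + psi) s =
  shift_sum b phi s + shift_sum b psi s).
by rewrite /shift_sum -big_split; apply: eq_bigr => g _; exact: mulrDr.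
Qed.

Lemma shift_sumZ b k phi : shift_sum b (k *: phi) = k *: shift_sum b phi.
Proof.
apply: funext => s; change (shift_sum b (k *: phi) s = k * shift_sum b phi s).
rewrite /shift_sum mulr_sumr.
by apply: eq_bigr => g _; exact: mulrCA.
Qed.

(** Frobenius: the [p]-th power of [sum b(g) g] is [sum b(g)^p g^p], and every [g^p] is the
    identity. *)
Lemma shift_sum_iter p b phi s :
  p \in [pchar K] -> (forall g : G, g *+ p = 0) -> shift_invariant b ->
  iter p (shift_sum b) phi s = (\sum_g b g s) ^+ p * phi s.
Proof.
move=> pK pG bI; have pp := pcharf_prime pK.
pose P g psi s := b g s * psi (map (act g) s).
have -> : shift_sum b = fun psi => \sum_(g : G) P g psi.
  by apply: funext => psi; apply: funext => u; rewrite fct_sumE.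
rewrite iter_frobenius_sum //; last 1 first.
- move=> g h psi; apply: funext => u; rewrite /P !bI -!map_actD addrC.
  by rewrite mulrCA.
- have -> : (\sum_g b g s) ^+ p = \sum_g b g s ^+ p.
    exact: (rmorph_sum (pFrobenius_aut pK)).
  rewrite fct_sumE mulr_suml; apply: eq_bigr => g _.
  have it n : iter n (P g) phi s = b g s ^+ n * phi (map (act (g *+ n)) s).
    elim: n s => [|n IH] u; first by rewrite mulr0n expr0 mul1r map_act0.
    by rewrite /= {1}/P IH bI exprS mulrA -map_actD -mulrSr.
  by rewrite it pG map_act0.
- by move=> psi; rewrite -scaler_nat (pcharf0 pK) scale0r.
- by move=> g psi psi'; apply: funext => u; exact: mulrDr.
Qed.

Lemma shift_sum_comm b c phi :
  shift_invariant b -> shift_invariant c ->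
  shift_sum b (shift_sum c phi) = shift_sum c (shift_sum b phi).
Proof.
move=> bI cI; apply: funext => s; rewrite /shift_sum.
under eq_bigr do rewrite mulr_sumr; rewrite exchange_big.
apply: eq_bigr => g _; rewrite mulr_sumr; apply: eq_bigr => h _.
by rewrite cI bI -!map_actD addrC mulrCA.
Qed.

End Shift.

Lemma alt_cochain_shift (K : fieldType) (X : eqType) (G : finZmodType)
    (act : G -> X -> X) (b : G -> seq X -> K) (phi : seq X -> K^o) :
  (forall g s t, perm_eq s t -> b g s = b g t) ->
  alt_cochain phi -> alt_cochain (shift_sum act b phi).
Proof.
move=> bP h; split=> [s x y t|s x t]; rewrite /shift_sum.
  rewrite -sumrN; apply: eq_bigr => g _.
  rewrite !map_cat /= h.1 mulrN; congr (- (_ * _)); apply: bP.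
  by rewrite perm_cat2l -![_ :: _ :: t]/([:: _; _] ++ t) perm_cat2r (perm_catC [:: x] [:: y]).
by rewrite big1 // => g _; rewrite map_cat /= h.2 mulr0.
Qed.

(** * Cochains on a complex without fixed simplices *)

Definition detecting_character (K : fieldType) (G : finZmodType) (theta : G -> K)
    (H : {set G}) (l : G -> K) :=
  [/\ forall g h, l (g + h) = l g + l h,
    forall h, h \in H -> l h = 0 & \sum_g theta g * l g != 0].

(* If moreover sum_g theta(g) = 0, this makes the permutation modules K[G/H],
   H <> G, free over the subalgebra generated by sum_g theta(g) g. *)
Definition generic (K : fieldType) (G : finZmodType) (theta : G -> K) :=
  forall H : {set G}, 0 \in H -> (forall g h, g \in H -> h \in H -> g + h \in H) ->
  (exists g, g \notin H) -> exists l, detecting_character theta H l.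

Section FixedPointFree.
Variables (K : fieldType) (p : nat) (G : finZmodType) (theta : G -> K).
Hypotheses (pK : p \in [pchar K]) (pG : forall g : G, g *+ p = 0).
Hypothesis theta_generic : generic theta.

Variable I : finType.
Definition label : finType := (I * G)%type.
Definition lact (g : G) (x : label) : label := (x.1, x.2 + g).

Lemma lact0 x : lact 0 x = x.
Proof. by case: x => c x; rewrite /lact /= addr0. Qed.

Lemma lactD g h x : lact (g + h) x = lact g (lact h x).
Proof. by rewrite /lact /= -addrA [h + g]addrC. Qed.

Definition full_column (A : {set label}) := [exists c, forall g, (c, g) \in A].
(** The complex [Y]: the join, over [I], of the boundaries of simplices with vertex set [G]. The
    empty set is left out, being fixed by [G]. *)
Definition is_face (A : {set label}) := (A != finset.set0) && ~~ full_column A.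
Definition vset (s : seq label) : {set label} := [set x in s].
Definition sact g (A : {set label}) := [set lact g x | x in A].

Lemma vset_map g s : vset (map (lact g) s) = sact g (vset s).
Proof.
apply/setP => x; rewrite inE; apply/mapP/imsetP => -[y ys ->]; exists y => //.
  by rewrite inE.
by move: ys; rewrite inE.
Qed.

Lemma sact0 A : sact 0 A = A.
Proof. by rewrite /sact (eq_imset _ lact0) imset_id. Qed.

Lemma sactD g h A : sact (g + h) A = sact g (sact h A).
Proof. by rewrite /sact -imset_comp; apply: eq_imset => x; rewrite lactD. Qed.

Lemma in_sact g A x : (x \in sact g A) = (lact (- g) x \in A).
Proof.
apply/imsetP/idP => [[y yA ->]|xA]; first by rewrite -lactD addNr lact0.
by exists (lact (- g) x); rewrite // -lactD addrN lact0.
Qed.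

Lemma sactK g : cancel (sact g) (sact (- g)).
Proof. by move=> A; rewrite -sactD addNr sact0. Qed.

Lemma is_face_sact g A : is_face (sact g A) = is_face A.
Proof.
have sub h B : is_face B -> is_face (sact h B).
  case/andP=> /set0Pn[x xB] nf; apply/andP; split.
    by apply/set0Pn; exists (lact h x); rewrite in_sact -lactD addNr lact0.
  apply: contra nf => /existsP[c /forallP fc]; apply/existsP; exists c.
  apply/forallP => k; have := fc (k + h); rewrite in_sact /lact /=.
  by rewrite addrK.
by apply/idP/idP => [/(sub (- g))|]; [rewrite sactK|apply: sub].
Qed.

Definition stab A := [set g | sact g A == A].

Lemma stab_sact g A : stab (sact g A) = stab A.
Proof.
apply/setP => h; rewrite !inE -sactD addrC sactD.
by rewrite (inj_eq (can_inj (sactK g))).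
Qed.

(** An invariant set that contains one label contains its whole column, which no face does. *)
Lemma stab_proper A : is_face A -> exists g, g \notin stab A.
Proof.
case/andP=> /set0Pn[[c x] xA] nf; apply/existsP; apply: contraNT nf.
rewrite negb_exists => /forallP st; apply/existsP; exists c.
apply/forallP => g; have := st (g - x); rewrite negbK inE => /eqP <-.
by rewrite in_sact /lact /= opprB addrC subrK.
Qed.

(** Chosen from the subgroup alone, so that all faces of one orbit share the same character. *)
Definition stab_char (H : {set G}) : G -> K :=
  if pselect (exists l, detecting_character theta H l) is left e
  then projT1 (cid e) else fun=> 0.

Definition face_char s := stab_char (stab (vset s)).

Lemma face_charP A : is_face A -> detecting_character theta (stab A) (stab_char (stab A)).
Proof.
move=> fA; rewrite /stab_char; case: pselect => [e|[]]; first exact: projT2 (cid e).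
apply: theta_generic (stab_proper fA).
  by rewrite inE sact0.
by move=> g h; rewrite !inE sactD => /eqP gA /eqP ->; rewrite gA.
Qed.

Definition orbit_rep A := choose (fun B => [exists g, sact g A == B]) A.
Definition transporter A := odflt 0 [pick g | sact g (orbit_rep A) == A].
(* On each orbit of faces, translation by g adds l(g) to the potential, for a
   character l that is trivial on the stabilizer; multiplication by it therefore
   has an invertible commutator with the shift operator. *)
Definition potential A := stab_char (stab A) (transporter A).

Lemma orbit_repP A : exists g, sact g A = orbit_rep A.
Proof.
have /existsP[g /eqP gA] : [exists g, sact g A == orbit_rep A].
  rewrite /orbit_rep.
  apply: (@chooseP _ (fun B => [exists g, sact g A == B])).
  by apply/existsP; exists 0; rewrite sact0.
by exists g.
Qed.

Lemma transporterP A : sact (transporter A) (orbit_rep A) = A.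
Proof.
rewrite /transporter; case: pickP => [g /eqP //|none] /=.
have [g gA] := orbit_repP A.
by have := none (- g); rewrite -gA sactK eqxx.
Qed.

Lemma orbit_rep_sact g A : orbit_rep (sact g A) = orbit_rep A.
Proof.
rewrite /orbit_rep.
have e : (fun B => [exists h, sact h (sact g A) == B]) =1
         (fun B => [exists h, sact h A == B]).
  move=> B; apply/existsP/existsP => -[h /eqP hA].
    by exists (h + g); rewrite sactD hA.
  by exists (h - g); rewrite -sactD subrK hA.
rewrite (eq_choose e); apply: choose_id; apply/existsP.
  by exists g.
by exists 0; rewrite sact0.
Qed.

(** The transporters of [sact g A] and [A] differ by [g] up to an element of the stabilizer, on
    which the character vanishes. *)
Lemma potential_sact g A : is_face A ->
  potential (sact g A) = potential A + stab_char (stab A) g.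
Proof.
move=> fA; have [lD l0 _] := face_charP fA.
rewrite /potential stab_sact.
set l := stab_char _ in lD l0 *.
set k := transporter _; set k' := transporter _.
have ek : sact k (orbit_rep A) = sact g A.
  by rewrite -(orbit_rep_sact g A) transporterP.
have ek' : sact k' (orbit_rep A) = A by apply: transporterP.
have e : k - (k' + g) \in stab A.
  rewrite inE -{1}ek' -sactD.
  have -> : k - (k' + g) + k' = - g + k by rewrite opprD [- k' - g]addrC -addrA subrK addrC.
  by rewrite sactD ek sactK.
by rewrite -(subrK (k' + g) k) lD (l0 _ e) add0r lD.
Qed.

Let T := shift_sum lact (fun g _ => theta g).
Let c g s := theta g * face_char s g.
Let csum s := \sum_g c g s.
(** On face cochains, [C] is the commutator of [T] with multiplication by [potential]. *)
Let C := shift_sum lact c.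

Definition face_cochain (phi : seq label -> K^o) :=
  alt_cochain phi /\ forall s, ~~ is_face (vset s) -> phi s = 0.

(** By Frobenius [C^p] is multiplication by [csum^p], which is nonzero on faces. Hence this is the
    potential times the inverse of [C]. *)
Definition homotopy (phi : seq label -> K^o) : seq label -> K^o :=
  fun s => potential (vset s) * ((csum s ^+ p)^-1 * iter p.-1 C phi s).

Lemma face_char_map g s : face_char (map (lact g) s) = face_char s.
Proof. by rewrite /face_char vset_map stab_sact. Qed.

Lemma vset_perm s t : perm_eq s t -> vset s = vset t.
Proof. by move=> /perm_mem st; apply/setP => x; rewrite !inE st. Qed.

Lemma c_invariant : shift_invariant lact c.
Proof. by move=> g h s; rewrite /c face_char_map. Qed.

Lemma theta_invariant : shift_invariant lact (fun g (_ : seq label) => theta g).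
Proof. by []. Qed.

Lemma csum_map g s : csum (map (lact g) s) = csum s.
Proof. by apply: eq_bigr => h _; rewrite c_invariant. Qed.

Lemma csum_neq0 s : is_face (vset s) -> csum s != 0.
Proof. by move=> /face_charP[]. Qed.

Lemma face_cochain_shift b phi :
  (forall g s t, perm_eq s t -> b g s = b g t) ->
  face_cochain phi -> face_cochain (shift_sum lact b phi).
Proof.
move=> bP [ap fp]; split; first exact: alt_cochain_shift.
move=> s nf; rewrite /shift_sum big1 // => g _.
by rewrite fp ?mulr0 // vset_map is_face_sact.
Qed.

Lemma face_cochainC phi : face_cochain phi -> face_cochain (C phi).
Proof.
by apply: face_cochain_shift => g s t st; rewrite /c /face_char (vset_perm st).
Qed.

Lemma face_cochainT phi : face_cochain phi -> face_cochain (T phi).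
Proof. exact: face_cochain_shift. Qed.

Lemma face_cochain_mul (a : {set label} -> K) phi :
  face_cochain phi -> face_cochain (fun s => a (vset s) * phi s).
Proof.
case=> -[p1 p2] fp; split=> [|s nf]; last by rewrite fp ?mulr0.
split=> [s x y t|s x t]; last by rewrite p2 mulr0.
rewrite p1 mulrN; congr (- (a _ * _)); apply: vset_perm.
by rewrite perm_cat2l -![_ :: _ :: t]/([:: _; _] ++ t) perm_cat2r (perm_catC [:: x] [:: y]).
Qed.

Lemma face_cochain_homotopy phi : face_cochain phi -> face_cochain (homotopy phi).
Proof.
move=> fp; have fC : face_cochain (iter p.-1 C phi).
  by elim: p.-1 => //= n; apply: face_cochainC.
exact/face_cochain_mul/(@face_cochain_mul
  (fun A => ((\sum_g theta g * stab_char (stab A) g) ^+ p)^-1)).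
Qed.

(** The inverse of [C] commutes with [T], so the commutator of [T] with [homotopy] is [C] times its
    inverse: the Weyl relation. *)
Lemma homotopyP phi : face_cochain phi ->
  T (homotopy phi) = homotopy (T phi) + phi.
Proof.
move=> fp; apply: funext => s.
change (T (homotopy phi) s = homotopy (T phi) s + phi s).
have [fs|nfs] := boolP (is_face (vset s)); last first.
  have [_ h1] := face_cochainT (face_cochain_homotopy fp).
  have [_ h2] := face_cochain_homotopy (face_cochainT fp).
  by rewrite h1 // h2 // fp.2 // addr0.
rewrite /homotopy; set psi := iter p.-1 C phi.
have -> : iter p.-1 C (T phi) = T psi.
  rewrite /psi; elim: p.-1 => //= n ->.
  exact: (shift_sum_comm lactD _ c_invariant theta_invariant).
have Cpsi : C psi s = csum s ^+ p * phi s.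
  rewrite -(shift_sum_iter lact0 lactD phi s pK pG c_invariant) /psi.
  by rewrite -[C _ s]/(iter p.-1.+1 C phi s) prednK // prime_gt0 // (pcharf_prime pK).
have cp0 : csum s ^+ p != 0 by rewrite expf_neq0 // csum_neq0.
have -> : phi s = (csum s ^+ p)^-1 * C psi s by rewrite Cpsi mulKf.
rewrite /T /C {1 2 3}/shift_sum !mulr_sumr -big_split /=; apply: eq_bigr => g _.
rewrite csum_map vset_map potential_sact // /c /face_char.
set a := potential _; set b := stab_char _ _; set d := _^-1; set q := psi _.
have aux (x y z w v : K) : x * ((y + z) * (w * v)) = y * (w * (x * v)) + w * (x * z * v).
  rewrite mulrDl mulrDr (mulrCA x y) (mulrCA x w); congr (_ + _).
  by rewrite (mulrCA z w) (mulrCA x w) -(mulrA x).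
exact: aux.
Qed.

Lemma face_cochainD phi psi :
  face_cochain phi -> face_cochain psi -> face_cochain (phi + psi).
Proof.
case=> -[a1 b1] f1 [[a2 b2] f2]; split=> [|s nf]; last first.
  by change (phi s + psi s = 0); rewrite f1 // f2 // addr0.
split=> [s x y t|s x t].
  change (phi (s ++ x :: y :: t) + psi (s ++ x :: y :: t) =
    - (phi (s ++ y :: x :: t) + psi (s ++ y :: x :: t))).
  by rewrite a1 a2 opprD.
by change (phi (s ++ x :: x :: t) + psi (s ++ x :: x :: t) = 0); rewrite b1 b2 addr0.
Qed.

Lemma face_cochainZ k phi : face_cochain phi -> face_cochain (k *: phi).
Proof. exact: (face_cochain_mul (fun=> k)). Qed.

Lemma homotopy0 : homotopy 0 = 0.
Proof.
apply: funext => s; rewrite /homotopy.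
have -> : iter p.-1 C 0 = 0.
  by apply: additive_op0; apply: additive_op_iter; apply: shift_sumD.
exact: etrans (congr1 _ (mulr0 _)) (mulr0 _).
Qed.

Lemma exact_T phi : face_cochain phi -> T phi = 0 ->
  exists2 psi, face_cochain psi & phi = iter p.-1 T psi.
Proof.
exact: (ker_sub_im_iter (pcharf_prime pK) pK (shift_sumD _ _) (@shift_sumZ _ _ _ _ _)
  homotopy0 face_cochainT face_cochain_homotopy face_cochainZ homotopyP).
Qed.

Lemma exact_iter_T phi : face_cochain phi -> iter p.-1 T phi = 0 ->
  exists2 psi, face_cochain psi & phi = T psi.
Proof.
exact: (ker_iter_sub_im pK (shift_sumD _ _) (@shift_sumZ _ _ _ _ _)
  homotopy0 face_cochainT face_cochain_homotopy face_cochainD face_cochainZ homotopyP).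
Qed.

End FixedPointFree.

(** * Barycentric subdivision *)

Section Subdivision.
Variables (K : fieldType) (R : realFieldType) (V : finType).
Local Notation pt := {ffun V -> R}.
Implicit Types (phi psi : seq pt -> K^o) (s t : seq pt) (x y : pt).

Definition barycenter s : pt :=
  [ffun v => (size s)%:R^-1 * \sum_(x <- s) x v].

Fixpoint subdiv_rec n phi s : K^o :=
  if n is n'.+1 then cobd (subdiv_rec n' (fun t => phi (barycenter s :: t))) s
  else phi s.

(* The transpose of barycentric subdivision of ordered affine chains:
   [x_0, ..., x_q] is sent to the cone with apex its barycenter over the
   subdivision of its boundary. *)
Definition subdiv phi s := subdiv_rec (size s) phi s.

Lemma subdiv_nil phi : subdiv phi [::] = phi [::].
Proof. by []. Qed.

Lemma subdivE phi s : (0 < size s)%N ->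
  subdiv phi s = cobd (subdiv (fun t => phi (barycenter s :: t))) s.
Proof.
rewrite {1}/subdiv; case e: (size s) => [//|n] _ /=.
by apply: cobd_eq => t _; rewrite e => -[<-].
Qed.

Lemma subdivD phi psi : subdiv (phi + psi) = subdiv phi + subdiv psi.
Proof.
apply: funext => s; change (subdiv (phi + psi) s = subdiv phi s + subdiv psi s).
have [n] := ubnP (size s); elim: n => // n IH in phi psi s *; rewrite ltnS => sn.
have [->//|s0] := eqVneq s [::]; have {}s0 : (0 < size s)%N by rewrite lt0n size_eq0.
rewrite !subdivE // -cobdD; apply: cobd_eq => t _ st.
by rewrite -[RHS](IH (fun t => phi (barycenter s :: t))
  (fun t => psi (barycenter s :: t))) // st.
Qed.

Lemma subdivZ k phi : subdiv (k *: phi) = k *: subdiv phi.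
Proof.
apply: funext => s; change (subdiv (k *: phi) s = k * subdiv phi s).
have [n] := ubnP (size s); elim: n => // n IH in phi s *; rewrite ltnS => sn.
have [->//|s0] := eqVneq s [::]; have {}s0 : (0 < size s)%N by rewrite lt0n size_eq0.
rewrite !subdivE // -cobdZ; apply: cobd_eq => t _ st.
by rewrite -[RHS](IH (fun t => phi (barycenter s :: t))) // st.
Qed.

(** The boundary of a cone is its base minus the cone over the boundary of the base. Here the base
    is a subdivided boundary, so by induction the second term is a double coboundary. *)
Lemma subdiv_cobd phi : subdiv (cobd phi) = cobd (subdiv phi).
Proof.
apply: funext => s.
have [n] := ubnP (size s); elim: n => // n IH in phi s *; rewrite ltnS => sn.
have [->//|s0] := eqVneq s [::]; have {}s0 : (0 < size s)%N by rewrite lt0n size_eq0.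
rewrite subdivE //; set psi := fun t => phi (barycenter s :: t).
transitivity (cobd (subdiv phi - cobd (subdiv psi)) s).
  apply: cobd_eq => t _ st.
  have -> : (fun t => cobd phi (barycenter s :: t)) = phi + (-1) *: cobd psi.
    by apply: funext => u; rewrite scaleN1r.
  rewrite subdivD subdivZ scaleN1r.
  by change (subdiv phi t - subdiv (cobd psi) t = subdiv phi t - cobd (subdiv psi) t);
     rewrite IH // st.
by rewrite cobdB cobd_cobd subr0.
Qed.

Lemma subdiv_map (f : pt -> pt) phi :
  (forall s, f (barycenter s) = barycenter (map f s)) ->
  subdiv (fun t => phi (map f t)) = fun s => subdiv phi (map f s).
Proof.
move=> fb; apply: funext => s; have [n] := ubnP (size s).
elim: n => // n IH in phi s *; rewrite ltnS => sn.
have [->//|s0] := eqVneq s [::]; have {}s0 : (0 < size s)%N by rewrite lt0n size_eq0.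
rewrite !subdivE ?size_map // -cobd_map; apply: cobd_eq => t _ st.
by rewrite /= -(IH (fun t => phi (barycenter (map f s) :: t))) ?st //= fb.
Qed.

Definition near_pts (e : R) x y := forall v, `|x v - y v| <= e.
Definition small (e : R) s := {in s &, forall x y, near_pts e x y}.
Definition barycentric (P : pt -> Prop) :=
  forall s, (0 < size s)%N -> {in s, forall x, P x} -> P (barycenter s).

Definition mesh_ratio m : R := m.-1%:R / m%:R.

Lemma barycenter_sub s (y : pt) v : (0 < size s)%N ->
  barycenter s v - y v = (size s)%:R^-1 * \sum_(x <- s) (x v - y v).
Proof.
move=> s0; rewrite ffunE big_split /= mulrDr; congr (_ + _).
rewrite sumrN big_const_seq count_predT iter_addr_0 -[y v *+ _]mulr_natl mulrN mulKf //.
by rewrite pnatr_eq0 -lt0n.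
Qed.

Lemma ler_norm_sum_size (T : eqType) (u : seq T) (F : T -> R) c :
  {in u, forall z, `|F z| <= c} -> `|\sum_(x <- u) F x| <= (size u)%:R * c.
Proof.
move=> h; apply: (le_trans (ler_norm_sum _ _ _)).
rewrite mulr_natl -iter_addr_0 -(count_predT u) -big_const_seq.
by rewrite ![\sum_(_ <- u) _]big_seq; apply: ler_sum => x /h.
Qed.

Lemma near_barycentric e y : barycentric (near_pts e y).
Proof.
move=> s s0 h v; rewrite distrC barycenter_sub // normrM ger0_norm ?invr_ge0 //.
rewrite ler_pdivrMl ?ltr0n //; apply: ler_norm_sum_size => x xs.
by rewrite distrC; apply: h.
Qed.

(** In the average of the differences [x - y] the term of [y] itself vanishes, leaving the factor
    [(q-1)/q] with [q = size s]; this factor grows with [q]. *)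
Lemma near_barycenter e s y m : (size s <= m)%N -> small e s -> y \in s ->
  near_pts (mesh_ratio m * e) (barycenter s) y.
Proof.
move=> sm se ys v; have s0 : (0 < size s)%N by case: s ys {sm se}.
have e0 : 0 <= e by apply: (le_trans (normr_ge0 _) (se y y ys ys v)).
rewrite barycenter_sub // normrM ger0_norm ?invr_ge0 //.
apply: (@le_trans _ _ (mesh_ratio (size s) * e)).
  rewrite /mesh_ratio mulrAC [X in _ <= X]mulrC ler_wpM2l ?invr_ge0 //.
  rewrite (perm_big _ (perm_to_rem ys)) big_cons /= subrr add0r.
  rewrite -(size_rem ys); apply: ler_norm_sum_size => x xs.
  by apply: se => //; apply: mem_rem xs.
rewrite ler_wpM2r // /mesh_ratio.
have m0 : (0 < m)%N by apply: leq_trans sm.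
rewrite ler_pdivrMr ?ltr0n // mulrAC ler_pdivlMr ?ltr0n // -!natrM ler_nat.
by rewrite -!subn1 !mulnBl mul1n mulnC leq_sub2l // mul1n.
Qed.

Lemma subdiv_local P e m phi psi s :
  barycentric P -> (size s <= m)%N -> {in s, forall x, P x} -> small e s ->
  (forall t, size t = size s -> {in t, forall x, P x} ->
     small (mesh_ratio m * e) t -> phi t = psi t) ->
  subdiv phi s = subdiv psi s.
Proof.
have [n] := ubnP (size s); elim: n => // n IH in P phi psi s *.
rewrite ltnS => sn bP sm Ps se h.
have [s0|s0] := eqVneq s [::].
  by rewrite s0 !subdiv_nil h ?s0.
have {}s0 : (0 < size s)%N by rewrite lt0n size_eq0.
rewrite !subdivE //; apply: cobd_eq => t ts st.
(* Adding nearness to the apex to the convex condition ensures that the apex stays close to every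
   vertex produced deeper in the recursion. *)
pose P' x := P x /\ near_pts (mesh_ratio m * e) (barycenter s) x.
apply: (IH P') => //.
- by rewrite st.
- move=> u u0 hu; split; first by apply: bP => // x /hu[].
  by apply: near_barycentric => // x /hu[].
- by rewrite (leq_trans _ sm) // -st.
- by move=> x /ts xs; split; [apply: Ps|apply: near_barycenter].
- by move=> x y /ts xs /ts ys; apply: se.
move=> u su Pu ue; apply: h; first by rewrite /= su.
  by move=> x; rewrite inE => /predU1P[->|/Pu[]//]; apply: bP.
move=> x y xu yu v.
have e0 : 0 <= mesh_ratio m * e.
  have [z zs] : exists x, x \in s.
    by case: (s) s0 => // z ? _; exists z; rewrite mem_head.
  by rewrite mulr_ge0 ?divr_ge0 //; apply: (le_trans (normr_ge0 _) (se z z zs zs v)).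
move: xu yu; rewrite !inE => /predU1P[->|xu] /predU1P[->|yu].
- by rewrite subrr normr0.
- by apply: (Pu y yu).2.
- by rewrite distrC; apply: (Pu x xu).2.
- exact: ue.
Qed.

End Subdivision.

(** * Equivariant labellings of the deleted join *)

Section EquivariantLabelling.
Variables (K : fieldType) (p : nat) (G : finZmodType) (theta : G -> K).
Hypotheses (pK : p \in [pchar K]) (pG : forall g : G, g *+ p = 0).
Hypothesis theta0 : \sum_g theta g = 0.
Hypothesis theta_generic : generic theta.
Variables (R : realFieldType) (I : finType) (m : nat).
Local Notation pt := {ffun 'I_m * G -> R}.
Local Notation lab := (label G I).
Local Notation TL := (shift_sum (@lact G I) (fun g _ => theta g)).

Definition pact (g : G) (x : pt) : pt := [ffun v => x (v.1, v.2 - g)].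
Definition vert (i : nat) (g : G) : pt :=
  [ffun v : 'I_m * G => ((v.1 == i :> nat) && (v.2 == g))%:R].
Local Notation TX := (shift_sum pact (fun g _ => theta g)).

Lemma pact0 x : pact 0 x = x.
Proof. by apply/ffunP => -[i g]; rewrite ffunE /= subr0. Qed.

Lemma pactD g h x : pact (g + h) x = pact g (pact h x).
Proof. by apply/ffunP => -[i k]; rewrite !ffunE /= opprD addrA. Qed.

Lemma pact_vert h i g : pact h (vert i g) = vert i (g + h).
Proof. by apply/ffunP => -[j k]; rewrite !ffunE /= subr_eq. Qed.

Lemma pact_barycenter g s : pact g (barycenter s) = barycenter (map (pact g) s).
Proof.
apply/ffunP => v; rewrite !ffunE size_map big_map.
by congr (_ * _); apply: eq_bigr => x _; rewrite ffunE.
Qed.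

(** The deleted join is the join of [m] copies of the discrete set [G]; its maximal simplices arise
    by selecting one vertex [tau i] in each copy. *)
Definition in_face (tau : 'I_m -> G) (x : pt) :=
  [/\ forall v, 0 <= x v, forall i g, g != tau i -> x (i, g) = 0
    & \sum_i x (i, tau i) = 1].

Lemma in_face_barycentric tau : barycentric (in_face tau).
Proof.
move=> s s0 h; have s0' : (size s)%:R != 0 :> R by rewrite pnatr_eq0 -lt0n.
split=> [v|i g gi|].
- rewrite ffunE mulr_ge0 ?invr_ge0 // big_seq sumr_ge0 // => x xs.
  by case: (h x xs).
- rewrite ffunE big_seq big1 ?mulr0 // => x xs; by have [_ ->] := h x xs.
- under eq_bigr do rewrite ffunE.
  rewrite -mulr_sumr exchange_big /= big_seq.
  rewrite (eq_bigr (fun=> 1)) => [|x /h[]//].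
  by rewrite -big_seq big_const_seq count_predT iter_addr_0 mulVf.
Qed.

Lemma in_face_pact tau g x :
  in_face tau x -> in_face (fun i => tau i + g) (pact g x).
Proof.
case=> x0 x1 x2; split=> [v|i h hi|]; first by rewrite ffunE.
  by rewrite ffunE x1 //= subr_eq.
by under eq_bigr do rewrite ffunE /= addrK.
Qed.

Lemma in_face_vert (tau : nat -> G) i : (i < m)%N ->
  in_face (fun j : 'I_m => tau j) (vert i (tau i)).
Proof.
move=> im; split=> [v|j g gj|]; first by rewrite ffunE.
  by rewrite ffunE /=; case: eqP => // ji; rewrite -ji (negbTE gj).
rewrite (bigD1 (Ordinal im)) //= ffunE !eqxx big1 ?addr0 // => j ji.
by rewrite ffunE /= -[_ == i]/(j == Ordinal im) (negbTE ji).
Qed.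

Fixpoint level n (tau : nat -> G) : seq pt :=
  vert n (tau n) :: if n is n'.+1 then level n' tau else [::].

Lemma size_level n tau : size (level n tau) = n.+1.
Proof. by elim: n => //= n ->. Qed.

Lemma level_eq n tau tau' :
  (forall i, (i <= n)%N -> tau i = tau' i) -> level n tau = level n tau'.
Proof.
elim: n => [|n IH] h /=; rewrite h // IH // => i ni; by rewrite h // ltnW.
Qed.

Lemma map_pact_level n tau g :
  map (pact g) (level n tau) = level n (fun i => tau i + g).
Proof. by elim: n => [|n IH] /=; rewrite pact_vert // IH. Qed.

Lemma in_face_level n (tau : nat -> G) : (n < m)%N ->
  {in level n tau, forall x, in_face (fun j : 'I_m => tau j) x}.
Proof.
elim: n => [|n IH] nm x /=; rewrite inE.
  by move=> /eqP ->; apply: in_face_vert.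
by case/predU1P => [->|]; [apply: in_face_vert|apply: IH; apply: ltnW].
Qed.

Lemma small_in_face tau s : {in s, forall x, in_face tau x} -> small 1 s.
Proof.
move=> h x y /h[x0 x1 x2] /h[y0 y1 y2] [i g].
have le1 (z : pt) : in_face tau z -> 0 <= z (i, g) <= 1.
  case=> z0 z1 z2; rewrite z0 /=.
  have [->|gi] := eqVneq g (tau i); last by rewrite z1.
  by rewrite -z2 (bigD1 i) //= lerDl sumr_ge0.
have /andP[a b] := le1 x (And3 x0 x1 x2); have /andP[c d] := le1 y (And3 y0 y1 y2).
by rewrite ler_norml; apply/andP; split; rewrite ?lerBlDr ?lerBrDr; lra.
Qed.

(** The differentials of the periodic resolution of the trivial module over [K[T]/(T^p)]. *)
Definition alternate X (T : (seq X -> K^o) -> seq X -> K^o) n :=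
  if odd n then T else iter p.-1 T.

(* Evaluation on the chains c_n of the join with c_0 = v_0 and
   c_(n+1) = v_(n+1) * T c_n or v_(n+1) * T^(p-1) c_n, where v_i = vert i 0. *)
Fixpoint ev n (phi : seq pt -> K^o) : K :=
  if n is n'.+1 then
    ev n' (alternate TX n (fun t => phi (vert n 0 :: t)))
  else phi [:: vert 0 0].

Section Alternate.
Variables (X : Type) (act : G -> X -> X).
Hypotheses (act0 : forall x, act 0 x = x)
  (actD : forall g h x, act (g + h) x = act g (act h x)).
Local Notation T := (shift_sum act (fun g _ => theta g)).

Implicit Types phi : seq X -> K^o.

Lemma alternateD n : additive_op (alternate T n).
Proof.
by rewrite /alternate; case: odd; [|apply: additive_op_iter]; apply: shift_sumD.
Qed.

Lemma iter_theta k phi : (p <= k)%N -> iter k T phi = 0.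
Proof.
move=> pk; rewrite -(subnK pk) iterD.
suff -> : iter p T phi = 0.
  by apply: additive_op0; apply: additive_op_iter; apply: shift_sumD.
apply: funext => s; rewrite (shift_sum_iter act0 actD _ _ pK) //.
by rewrite theta0 expr0n gtn_eqF ?mul0r ?prime_gt0 ?(pcharf_prime pK).
Qed.

Lemma alternate_alternate n phi : alternate T n (alternate T n.+1 phi) = 0.
Proof.
have pp := prime_gt0 (pcharf_prime pK).
rewrite /alternate /=; case: odd => /=.
  by rewrite -iterS iter_theta // prednK.
by rewrite -iterSr iter_theta // prednK.
Qed.

Lemma shift_sum_cobd b phi :
  shift_sum act (fun g _ => b g) (cobd phi) = cobd (shift_sum act (fun g _ => b g) phi).
Proof.
apply: funext => s; rewrite /shift_sum.
have -> : (fun s => \sum_g b g * phi (map (act g) s)) =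
   \sum_g b g *: (fun s => phi (map (act g) s)) :> (seq X -> K^o).
  by apply: funext => u; rewrite fct_sumE.
elim/big_rec2: _ => [|g u v _ ->]; first by rewrite cobd0.
by rewrite cobdD cobdZ cobd_map.
Qed.

Lemma iter_shift_sum_cobd b k phi :
  iter k (shift_sum act (fun g _ => b g)) (cobd phi) =
  cobd (iter k (shift_sum act (fun g _ => b g)) phi).
Proof. by elim: k => //= k ->; rewrite shift_sum_cobd. Qed.

Lemma alternate_cobd n phi : alternate T n (cobd phi) = cobd (alternate T n phi).
Proof.
by rewrite /alternate; case: odd; [apply: shift_sum_cobd|apply: iter_shift_sum_cobd].
Qed.

End Alternate.

Implicit Types (phi psi chi : seq pt -> K^o) (tau : nat -> G).

Lemma iter_TX_level k n (phi psi : seq pt -> K^o) :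
  (forall tau, phi (level n tau) = psi (level n tau)) ->
  forall tau, iter k TX phi (level n tau) = iter k TX psi (level n tau).
Proof.
move=> h; elim: k => //= k IH tau; rewrite /shift_sum; apply: eq_bigr => g _.
by rewrite map_pact_level IH.
Qed.

Lemma alternate_TX_level j n (phi psi : seq pt -> K^o) :
  (forall tau, phi (level n tau) = psi (level n tau)) ->
  forall tau, alternate TX j phi (level n tau) = alternate TX j psi (level n tau).
Proof.
move=> h; rewrite /alternate; case: odd; last exact: iter_TX_level.
exact: (@iter_TX_level 1).
Qed.

Lemma ev_eq n phi psi :
  (forall tau, phi (level n tau) = psi (level n tau)) -> ev n phi = ev n psi.
Proof.
elim: n phi psi => [|n IH] phi psi h /=; first exact: (h (fun=> 0)).
apply: IH; apply: alternate_TX_level => tau.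
(* The apex added last is always [vert n.+1 0], so [tau] is overwritten there, which leaves the
   lower levels unchanged. *)
have := h (fun i => if (i == n.+1)%N then 0 else tau i); rewrite /= eqxx.
by rewrite (@level_eq n _ tau) // => i ni; rewrite ltn_eqF.
Qed.

Lemma evD n phi psi : ev n (phi + psi) = ev n phi + ev n psi.
Proof.
elim: n phi psi => [|n IH] phi psi //=; rewrite -IH.
congr (ev n _); exact: alternateD.
Qed.

Lemma ev0 n : ev n 0 = 0.
Proof. by apply: (@addIr _ (ev n 0)); rewrite -evD addr0 add0r. Qed.

Lemma evS n phi :
  ev n.+1 phi = ev n (alternate TX n.+1 (fun t => phi (vert n.+1 0 :: t))).
Proof. by []. Qed.

Lemma cobd_cons psi x : (fun t => cobd psi (x :: t)) =
  psi + cobd (- (fun t => psi (x :: t))).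
Proof.
apply: funext => t; rewrite -[RHS]/(psi t + cobd _ t).
by rewrite -scaleN1r cobdZ mulN1r.
Qed.

(** The boundary of the cone [c_(n+1)] is its base minus a cone over the boundary of the base. The
    latter involves [T^p = 0], two consecutive differentials having composed. *)
Lemma ev_cobd n psi : ev n.+1 (cobd psi) = ev n (alternate TX n.+1 psi).
Proof.
elim: n psi => [|n IH] psi; rewrite evS cobd_cons alternateD evD -[RHS]addr0;
  congr (_ + _); rewrite alternate_cobd.
  (* In the lowest degree only the augmentation remains, and [T] multiplies it by the sum of
     [theta], which is 0. *)
  move: (- _) => chi; rewrite /= subr0.
  by apply: etrans (esym (mulr_suml _ _ theta (chi [::]))) _; rewrite theta0 mul0r.
by rewrite IH alternate_alternate ?ev0 //; [exact: pact0|exact: pactD].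
Qed.

Variable lam : pt -> lab.
Hypothesis lamE : forall tau' x g, in_face tau' x -> lam (pact g x) = lact g (lam x).
Variable N : nat.
Hypothesis small_not_full : forall tau' t, {in t, forall x, in_face tau' x} ->
  small (mesh_ratio R m ^+ N) t -> ~~ full_column (vset (map lam t)).

Definition pullback (z : seq lab -> K^o) : seq pt -> K^o :=
  iter N (@subdiv K R _) (fun t => z (map lam t)).

Lemma iter_subdiv_local e tau' k phi psi s :
  (size s <= m)%N -> {in s, forall x, in_face tau' x} -> small e s ->
  (forall t, size t = size s -> {in t, forall x, in_face tau' x} ->
     small (mesh_ratio R m ^+ k * e) t -> phi t = psi t) ->
  iter k (@subdiv K R _) phi s = iter k (@subdiv K R _) psi s.
Proof.
elim: k e s => [|k IH] e s sm sf se h /=; first by apply: h; rewrite ?expr0 ?mul1r.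
apply: (subdiv_local (@in_face_barycentric tau') sm sf se) => t ts tf te.
apply: (IH (mesh_ratio R m * e)) => //; first by rewrite ts.
by move=> u us uf ue; apply: h; rewrite ?us // exprSr -mulrA.
Qed.

(** After [N] subdivisions every simplex of a level is small, so its labels fill no column and span
    a face of [Y]. *)
Lemma pullback_local n tau phi psi : (n < m)%N ->
  (forall tau' t, size t = n.+1 -> {in t, forall x, in_face tau' x} ->
     is_face (vset (map lam t)) -> phi t = psi t) ->
  iter N (@subdiv K R _) phi (level n tau) = iter N (@subdiv K R _) psi (level n tau).
Proof.
move=> nm h; have fl := @in_face_level n tau nm.
apply: (iter_subdiv_local _ fl (small_in_face fl)); first by rewrite size_level.
move=> t; rewrite size_level => ts tf; rewrite mulr1 => te.
apply: (h _ t ts tf); rewrite /is_face (small_not_full tf te) andbT.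
case: t ts {tf te} => // x t _; apply/set0Pn; exists (lam x).
by rewrite inE map_f // mem_head.
Qed.

Lemma subdiv_TX phi : TX (subdiv phi) = subdiv (TX phi).
Proof.
have sc g : (fun s => subdiv phi (map (pact g) s)) = subdiv (fun t => phi (map (pact g) t)).
  by rewrite (subdiv_map _ (pact_barycenter g)).
apply: funext => s; rewrite /shift_sum.
have -> : (fun s => \sum_g theta g * phi (map (pact g) s)) =
   \sum_g theta g *: (fun s => phi (map (pact g) s)) :> (seq pt -> K^o).
  by apply: funext => u; rewrite fct_sumE.
rewrite (additive_op_sum _ _ _ (@subdivD _ _ _)) fct_sumE; apply: eq_bigr => g _.
by rewrite subdivZ -sc.
Qed.

Lemma iter_subdiv_TX k phi :
  iter k TX (iter N (@subdiv K R _) phi) = iter N (@subdiv K R _) (iter k TX phi).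
Proof.
elim: k => //= k ->; elim: N => //= j IH; by rewrite subdiv_TX IH.
Qed.

Lemma iter_subdiv_cobd phi :
  cobd (iter N (@subdiv K R _) phi) = iter N (@subdiv K R _) (cobd phi).
Proof. by elim: N => //= j IH; rewrite -subdiv_cobd IH. Qed.

Lemma iter_T_pullback k n z tau : (n < m)%N ->
  iter k TX (pullback z) (level n tau) = pullback (iter k TL z) (level n tau).
Proof.
move=> nm; rewrite /pullback iter_subdiv_TX; apply: (pullback_local _ nm).
move=> tau' t _ + _; elim: k t tau' => //= k IH t tau' tf.
rewrite {1}/shift_sum; apply: eq_bigr => g _; congr (_ * _).
rewrite (IH _ (fun i => tau' i + g)).
  congr (iter k TL z _); rewrite -!map_comp; apply/eq_in_map => x /tf xf /=.
  exact: lamE xf.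
by move=> _ /mapP[x /tf xf ->]; apply: in_face_pact.
Qed.

Lemma alternate_pullback j n z tau : (n < m)%N ->
  alternate TX j (pullback z) (level n tau) = pullback (alternate TL j z) (level n tau).
Proof.
by rewrite /alternate; case: odd; [apply: (@iter_T_pullback 1)|apply: iter_T_pullback].
Qed.

(** Cochains of [Y] are extended by zero to all label sequences; [cobd] followed by this truncation
    is the coboundary of [Y]. *)
Definition on_faces (z : seq lab -> K^o) : seq lab -> K^o :=
  fun s => (is_face (vset s))%:R * z s.

Lemma on_facesE z s : is_face (vset s) -> on_faces z s = z s.
Proof. by rewrite /on_faces => ->; apply: mul1r. Qed.

Lemma on_faces_cochain z : alt_cochain z -> face_cochain (on_faces z).
Proof.
move=> [a b]; split=> [|s /negbTE nf]; last by rewrite /on_faces nf; apply: mul0r.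
split=> [s x y t|s x t]; last by rewrite /on_faces b; apply: mulr0.
rewrite /on_faces a (@vset_perm _ _ _ (s ++ y :: x :: t)); first exact: mulrN.
by rewrite perm_cat2l -![_ :: _ :: t]/([:: _; _] ++ t) perm_cat2r (perm_catC [:: x] [:: y]).
Qed.

Lemma vset_lact g (s : seq lab) :
  is_face (vset (map (@lact G I g) s)) = is_face (vset s).
Proof. by rewrite vset_map is_face_sact. Qed.

Lemma iter_TL_on_faces k z :
  iter k TL (on_faces z) = on_faces (iter k TL z).
Proof.
elim: k => //= k ->; apply: funext => s; rewrite /on_faces /shift_sum.
under eq_bigr => g _ do rewrite vset_lact mulrCA.
by rewrite -mulr_sumr.
Qed.

Lemma alternate_on_faces n z : alternate TL n (on_faces z) = on_faces (alternate TL n z).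
Proof.
by rewrite /alternate; case: odd; [apply: (@iter_TL_on_faces 1)|apply: iter_TL_on_faces].
Qed.

(** Nonempty subsets of faces are faces, so the inner truncation is invisible on a face; on the
    empty sequence [cobd] is 0 anyway. *)
Lemma on_faces_cobd_cobd z : on_faces (cobd (on_faces (cobd z))) = 0.
Proof.
apply: funext => s; rewrite /on_faces; have [fs|_] := boolP (is_face _); last exact: mul0r.
transitivity (cobd (cobd z) s); last exact: cobd_cobd.
rewrite mul1r; apply: cobd_eq => t ts _; case: t ts => [|x t] ts; first exact: mulr0.
suff -> : is_face (vset (x :: t)) by apply: mul1r.
case/andP: fs => _ nf; apply/andP; split.
  by apply/set0Pn; exists x; rewrite inE mem_head.
apply: contra nf => /existsP[c /forallP fc]; apply/existsP; exists c; apply/forallP => g.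
by have := fc g; rewrite !inE; apply: ts.
Qed.

Lemma alternate_exact n z : face_cochain z -> alternate TL n z = 0 ->
  exists2 z', face_cochain z' & z = alternate TL n.+1 z'.
Proof.
rewrite /alternate /=; case: odd => /=; first exact: exact_T.
exact: exact_iter_T.
Qed.

Lemma pullback_on_faces n z tau : (n < m)%N ->
  pullback (on_faces z) (level n tau) = pullback z (level n tau).
Proof.
move=> nm; apply: (pullback_local _ nm) => tau' t _ _ ft; exact: on_facesE.
Qed.

Lemma cobd_pullback z : cobd (pullback z) = pullback (cobd z).
Proof.
rewrite /pullback iter_subdiv_cobd; congr (iter N _ _); apply: funext => s.
by rewrite cobd_map.
Qed.

Lemma exists_cochain n : (n < m)%N -> exists z : seq lab -> K^o,
  [/\ face_cochain z, on_faces (alternate TL n (cobd z)) = 0 &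
      ev n (iter p.-1 TX (pullback z)) = 1].
Proof.
have pp := pcharf_prime pK.
elim: n => [m0|n IH nm].
  (* The unit cochain in degree -1. Its coboundary is 1 on each vertex and is killed by [T], because
     [theta] sums to 0. *)
  pose eps : seq lab -> K^o := fun s => (nilp s)%:R.
  have eps_alt : alt_cochain eps by split=> [[|? ?] a b t|[|? ?] a t]; rewrite /eps /= ?oppr0.
  have Teps : TL (cobd eps) = 0.
    rewrite shift_sum_cobd; apply: funext => s.
    have -> : TL eps = 0; last exact: cobd0.
    apply: funext => u; rewrite /shift_sum.
    under eq_bigr => g _ do rewrite /eps /nilp size_map.
    by rewrite -mulr_suml theta0 mul0r.
  have h1 : face_cochain (on_faces (cobd eps)) by apply/on_faces_cochain/alt_cochain_cobd.
  have [z fz zE] : exists2 z, face_cochain z & on_faces (cobd eps) = iter p.-1 TL z.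
    apply: exact_T => //; apply: etrans (iter_TL_on_faces 1 _) _; rewrite /= Teps.
    by apply: funext => s; apply: mulr0.
  exists z; split=> //.
    by rewrite alternate_cobd /alternate /= -zE on_faces_cobd_cobd.
  rewrite /= -[[:: vert 0 0]]/(level 0 (fun=> 0)) iter_T_pullback // -zE.
  rewrite pullback_on_faces // -cobd_pullback /= subr0 /pullback.
  by elim: N.
have [z [fz z0 z1]] := IH (ltnW nm).
have h1 : face_cochain (on_faces (cobd z)).
  by apply/on_faces_cochain/alt_cochain_cobd; case: fz.
have [|z' fz' zE] := @alternate_exact n _ h1; first by rewrite alternate_on_faces.
exists z'; split=> //; first by rewrite alternate_cobd -zE on_faces_cobd_cobd.
have key tau : cobd (pullback z) (level n.+1 tau) =
    alternate TX n.+1 (pullback z') (level n.+1 tau).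
  by rewrite alternate_pullback // -zE pullback_on_faces // cobd_pullback.
(* If [dz = T z'], then [T^(p-1) z' = d (T^(p-2) z)], whose value is that of [T^(p-1) z]. If
   [dz = T^(p-1) z'], [ev_cobd] applies to [z] itself. *)
case: (boolP (odd n.+1)) => on; rewrite {}/alternate ?on ?(negbTE on) in key.
  have p2 : p.-1 = p.-2.+1 by rewrite [in RHS]prednK // -ltnS prednK ?prime_gt1 ?prime_gt0.
  have := ev_cobd n (iter p.-2 TX (pullback z)).
  rewrite /alternate on -iterS -p2 z1 => <-.
  apply: ev_eq => tau; rewrite p2 iterSr -iter_shift_sum_cobd.
  apply: iter_TX_level => tau'; by rewrite key.
have := ev_cobd n (pullback z); rewrite /alternate (negbTE on) z1 => <-.
by apply: ev_eq => tau; rewrite key.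
Qed.

Lemma card_not_full (A : {set lab}) :
  ~~ full_column A -> (#|A| <= #|I| * #|G|.-1)%N.
Proof.
move=> nf; have col c : (#|[set g | (c, g) \in A]| <= #|G|.-1)%N.
  rewrite -ltnS prednK; last by apply/card_gt0P; exists 0.
  rewrite -cardsT; apply: proper_card; rewrite finset.properEneq finset.subsetT andbT.
  apply: contra nf => /eqP e; apply/existsP; exists c; apply/forallP => g.
  by have : g \in [set: G] := finset.in_setT g; rewrite -e inE.
have -> : #|A| = (\sum_c #|[set g | (c, g) \in A]|)%N.
  rewrite -sum1_card (eq_bigr (fun c => \sum_(g | (c, g) \in A) 1)%N); last first.
    by move=> c _; rewrite sum1_card; apply: eq_card => g; rewrite inE.
  by rewrite pair_big_dep /=; apply: eq_bigl => -[c g].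
by apply: leq_trans (leq_sum _ (fun c _ => col c)) _; rewrite sum_nat_const.
Qed.

(** Level [m.-1] carries [m] labels, one more than a face of [Y] can hold. The alternating cochain
    [z] thus pulls back to 0 there, against the value 1. *)
Lemma labelling_contra : m = (#|I| * #|G|.-1).+1 -> False.
Proof.
move=> mE; have [|z [[za z0] _]] := @exists_cochain m.-1; first by rewrite mE.
rewrite (@ev_eq _ _ 0); first by rewrite ev0 => /esym/eqP; rewrite oner_eq0.
move=> tau; rewrite (@iter_TX_level _ _ _ 0).
  by rewrite (additive_op0 (additive_op_iter _ (shift_sumD _ _))).
move=> tau'; have -> : 0 = pullback 0.
  by apply: esym; exact: (additive_op0 (additive_op_iter N (@subdivD K R _))).
apply: pullback_local => [|tau'' t ts _ ft]; first by rewrite mE.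
apply: alt_cochain_non_uniq => //; apply/negP => un.
have /andP[_ /card_not_full] := ft.
rewrite /vset cardsE (card_uniqP un) size_map ts.
by rewrite mE /= ltnn.
Qed.

End EquivariantLabelling.

Theorem equivariant_labelling (K : fieldType) (p : nat) (G : finZmodType)
    (theta : G -> K) (R : realFieldType) (I : finType) :
  p \in [pchar K] -> (forall g : G, g *+ p = 0) -> \sum_g theta g = 0 ->
  generic theta ->
  forall m (lam : {ffun 'I_m * G -> R} -> I * G), m = (#|I| * #|G|.-1).+1 ->
  (forall tau x g, in_face tau x -> lam (pact g x) = lact g (lam x)) ->
  forall N, exists tau t, [/\ {in t, forall x, in_face tau x},
    small (mesh_ratio R m ^+ N) t & full_column (vset (map lam t))].
Proof.
move=> pK pG th0 thd m lam mE lamE N; apply: contrapT => h.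
apply: (labelling_contra pK pG th0 thd lamE (N := N) _ mE) => tau t tf te.
by apply/negP => fc; apply: h; exists tau, t.
Qed.

(** * Elementary abelian groups and a generic nilpotent element over [F_p(X)] *)

Section ElementaryAbelian.
Variables (p e : nat).
Hypothesis p_prime : prime p.
Local Notation G := 'rV['F_p]_e.
Local Notation K := {fraction {poly 'F_p}}.
Local Notation "x %:F" := (@FracField.tofrac {poly 'F_p} x).

Lemma pchar_fraction : p \in [pchar K].
Proof.
rewrite inE p_prime /=; apply/eqP.
rewrite -(rmorph_nat (@FracField.tofrac {poly 'F_p})) -(rmorph_nat (@polyC 'F_p)).
by rewrite pchar_Fp_0 // !rmorph0.
Qed.

Lemma elementary_mulrn (g : G) : g *+ p = 0.
Proof. by rewrite -scaler_nat pchar_Fp_0 // scale0r. Qed.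

(** Scalars of [F_p] are multiples of 1, so [H] is a proper linear subspace; a nonzero column of the
    cokernel of a spanning matrix annihilates it. *)
Lemma subgroup_annihilator (H : {set G}) :
  0 \in H -> (forall g h, g \in H -> h \in H -> g + h \in H) ->
  (exists g, g \notin H) ->
  exists2 w : 'cV['F_p]_e, w != 0 & forall h, h \in H -> h *m w = 0.
Proof.
move=> H0 HD [g gH]; pose B := \matrix_(i < #|H|) (enum_val i : G).
have Hsum (J : finType) (F : J -> G) : (forall j, F j \in H) -> \sum_j F j \in H.
  by move=> FH; elim/big_rec: _ => // j x _; apply: HD.
have HZ (c : 'F_p) h : h \in H -> c *: h \in H.
  move=> hH; rewrite -[c]natr_Zp scaler_nat.
  elim: (c : nat) => [|n IH]; first by rewrite mulr0n.
  by rewrite mulrS HD.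
have nfull : ~~ row_full B.
  apply: contra gH => fB; have /submxP[D ->] := submx_full g fB.
  rewrite mulmx_sum_row; apply: Hsum => i; apply: HZ; rewrite rowK.
  exact: enum_valP.
have : cokermx B != 0 by rewrite cokermx_eq0.
case/matrix0Pn => i [j cij]; exists (col j (cokermx B)).
  by apply/matrix0Pn; exists i, 0; rewrite mxE.
move=> h hH; have -> : h = row (enum_rank_in hH h) B by rewrite rowK enum_rankK_in.
by rewrite colE mulmxA -row_mul mulmx_coker row0 mul0mx.
Qed.

(* This is sum_i X^i (e_i - 1) for the canonical basis e_i of G: as the X^i are
   linearly independent over F_p, no nonzero character kills it. *)
Definition generic_shift (g : G) : K :=
  \sum_(i < e) ('X^i)%:F * ((g == delta_mx 0 i)%:R - (g == 0)%:R).

Lemma sum_generic_shift (l : G -> K) :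
  \sum_g generic_shift g * l g = \sum_(i < e) ('X^i)%:F * (l (delta_mx 0 i) - l 0).
Proof.
have pick h : \sum_g (g == h)%:R * l g = l h.
  rewrite (bigD1 h) //= eqxx mul1r big1 ?addr0 // => g /negbTE ->.
  by rewrite mul0r.
under eq_bigr do rewrite /generic_shift mulr_suml.
rewrite exchange_big; apply: eq_bigr => i _ /=.
under eq_bigr do rewrite -mulrA mulrBl.
by rewrite -mulr_sumr sumrB !pick.
Qed.

(** Pairing with the character given by an annihilating vector [w] yields the polynomial
    [sum_i w_i X^i], which is nonzero since [w] is. *)
Lemma generic_shiftP : generic generic_shift.
Proof.
move=> H H0 HD HT; have [w w0 wH] := subgroup_annihilator H0 HD HT.
exists (fun g => ((g *m w) 0 0)%:P%:F); split.
- by move=> g h; rewrite mulmxDl mxE polyCD rmorphD.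
- by move=> h hH; rewrite wH // mxE polyC0 rmorph0.
rewrite sum_generic_shift.
have -> : \sum_(i < e) ('X^i)%:F *
     ((((delta_mx 0 i : G) *m w) 0 0)%:P%:F - (((0 : G) *m w) 0 0)%:P%:F)
   = (\poly_(i < e) (if insub i is Some j then w (j : 'I_e) 0 else 0))%:F.
  rewrite poly_def rmorph_sum. apply: eq_bigr => i _.
  rewrite mul0mx [X in _ - X%:P%:F]mxE polyC0 rmorph0 subr0 -rowE mxE valK.
  by rewrite -rmorphM mulrC mul_polyC.
rewrite tofrac_eq0; apply: contra w0 => /eqP/polyP h.
apply/eqP/matrixP => i j; rewrite (ord1 j) mxE.
by have := h i; rewrite coef_poly ltn_ord valK coef0.
Qed.

Lemma card_elementary : #|G| = (p ^ e)%N.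
Proof. by rewrite card_mx card_Fp // mul1n. Qed.

Theorem elementary_labelling (R : realFieldType) (I : finType) m
    (lam : {ffun 'I_m * G -> R} -> I * G) :
  m = (#|I| * (p ^ e).-1).+1 ->
  (forall tau x g, in_face tau x -> lam (pact g x) = lact g (lam x)) ->
  forall N, exists tau t, [/\ {in t, forall x, in_face tau x},
    small (mesh_ratio R m ^+ N) t & full_column (vset (map lam t))].
Proof.
move=> mE; apply: (equivariant_labelling pchar_fraction elementary_mulrn _ generic_shiftP).
  have := sum_generic_shift (fun=> 1); under eq_bigr do rewrite mulr1.
  by move=> ->; rewrite big1 // => i _; rewrite subrr mulr0.
by rewrite card_elementary.
Qed.

End ElementaryAbelian.

Local Open Scope classical_set_scope.
Local Open Scope ring_scope.

(** * The topological Tverberg theorem for prime powers *)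

Section RealAnalysis.
Variable R : realType.

Lemma cvg_bigop (op : R -> R -> R) (idx : R) (T : Type) (F : set_system T)
    {FF : Filter F} (I : Type) (r : seq I) (P : pred I) (f : I -> T -> R) (a : I -> R) :
  (forall (u v : T -> R) (b c : R), u x @[x --> F] --> b -> v x @[x --> F] --> c ->
    op (u x) (v x) @[x --> F] --> op b c) ->
  (forall i, f i x @[x --> F] --> a i) ->
  \big[op/idx]_(i <- r | P i) f i x @[x --> F] --> \big[op/idx]_(i <- r | P i) a i.
Proof.
move=> hop h; elim: r => [|i r IH].
  by rewrite big_nil; under eq_fun do rewrite big_nil; apply: cvg_cst.
rewrite big_cons; under eq_fun do rewrite big_cons.
by case: (P i) => //; apply: hop.
Qed.

Lemma cvg_bigsum (T : Type) (F : set_system T) {FF : Filter F} (I : Type)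
    (r : seq I) (P : pred I) (f : I -> T -> R) (a : I -> R) :
  (forall i, f i x @[x --> F] --> a i) ->
  \sum_(i <- r | P i) f i x @[x --> F] --> \sum_(i <- r | P i) a i.
Proof. by apply: cvg_bigop => u v b c; apply: cvgD. Qed.

Lemma cvg_bigprod (T : Type) (F : set_system T) {FF : Filter F} (I : Type)
    (r : seq I) (P : pred I) (f : I -> T -> R) (a : I -> R) :
  (forall i, f i x @[x --> F] --> a i) ->
  \prod_(i <- r | P i) f i x @[x --> F] --> \prod_(i <- r | P i) a i.
Proof. by apply: cvg_bigop => u v b c; apply: cvgM. Qed.

Lemma cvg_rowmx (T : Type) (F : set_system T) {FF : Filter F} n
    (f : 'I_n -> T -> R) (a : 'I_n -> R) :
  (forall i, f i x @[x --> F] --> a i) ->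
  \row_i f i x @[x --> F] --> \row_i a i.
Proof.
move=> h; apply/cvg_ballP => e e0.
have : \forall x \near F, forall i, ball (a i) e (f i x).
  by apply: filter_forall => i; move/cvg_ballP: (h i) => /(_ e e0).
by apply: filterS => x hx; split=> // i j; rewrite !mxE.
Qed.

Lemma simplex_closed n : closed (simplex R n).
Proof.
have -> : simplex R n = (\bigcap_(i in [set: 'I_n.+1])
    (fun x : 'rV[R]_n.+1 => x ord0 i) @^-1` [set y | 0 <= y]) `&`
    (fun x : 'rV[R]_n.+1 => \sum_i x ord0 i) @^-1` [set y | y = 1].
  by apply/seteqP; split=> x [h1 h2]; split=> // i; [move=> _; apply: h1|apply: (h1 i)].
apply: closedI.
  apply: closed_bigI => i _; apply: preimage_closed (@closed_ge _ 0).
  by move=> x _; apply: coord_continuous.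
apply: preimage_closed (@closed_eq _ 1) => x _.
by apply: (@cvg_bigsum _ (nbhs x)) => i; apply: coord_continuous.
Qed.

Lemma simplex_le1 n (x : 'rV[R]_n.+1) i : simplex R n x -> x ord0 i <= 1.
Proof. by case=> x0 <-; rewrite (bigD1 i) //= lerDl sumr_ge0. Qed.

Lemma simplex_compact n : compact (simplex R n).
Proof.
apply: (@subclosed_compact _ _ [set v : 'rV[R]_n.+1 | forall i, [set` `[0, 1]] (v ord0 i)]).
- exact: simplex_closed.
- by apply: (@rV_compact R n.+1 (fun=> [set` `[0, 1]])) => i; apply: segment_compact.
- move=> x sx i /=; rewrite in_itv /= (simplex_le1 _ sx) andbT.
  by case: sx.
Qed.

Lemma simplex_extension n (f : 'rV[R]_n.+1 -> R) :
  {within simplex R n, continuous f} ->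
  exists (g : 'rV[R]_n.+1 -> R) (M : R),
    [/\ forall x, simplex R n x -> g x = f x, continuous g
      & forall x, `|g x| <= M].
Proof.
move=> fc; have /compact_bounded[M [_ bM]] := continuous_compact fc (@simplex_compact n).
pose M' := Num.max M 0 + 1.
have M0 : 0 < M' by rewrite ltr_pwDr // le_max lexx orbT.
have MM : M < M' by rewrite /M' ltr_pwDr // le_max lexx.
have [|g [fg gc gb]] := @continuous_bounded_extension _ R
   (@pseudometric_normal R 'rV[R]_n.+1) _ (@simplex_closed n) f M' M0 fc.
  by move=> x sx; apply: (bM M' MM); exists x.
by exists g, M'; split=> // x sx; rewrite fg // inE.
Qed.

Definition mass n (y : 'rV[R]_n) := \sum_i y ord0 i.
(** The homogeneous extension of degree 1 of [g] from the points of mass 1; for [g = 1] it is the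
    mass itself. *)
Definition cone n (g : 'rV[R]_n -> R) y := mass y * g ((mass y)^-1 *: y).

Lemma mass_continuous n : continuous (@mass n).
Proof. by move=> x; apply: (@cvg_bigsum _ (nbhs x)) => i; apply: coord_continuous. Qed.

(* Where the mass vanishes, [cone g] is 0 and continuity comes from [g] being
   bounded. *)
Lemma cone_continuous n (g : 'rV[R]_n -> R) M :
  continuous g -> (forall x, `|g x| <= M) -> continuous (cone g).
Proof.
move=> gc gM y; have [y0|y0] := eqVneq (mass y) 0; last first.
  apply: continuousM; first exact: mass_continuous.
  apply: continuous_comp; last exact: gc.
  apply: continuousZ; last by [].
  by apply: continuousV; first by []; exact: mass_continuous.
have cy : cone g y = 0 by rewrite /cone y0 mul0r.
change (cone g z @[z --> y] --> cone g y); rewrite cy.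
have nF : Filter (nbhs y) by exact: nbhs_filter.
have tc : M * `|mass z| @[z --> y] --> 0.
  have h : mass z @[z --> y] --> mass y by exact: mass_continuous.
  have := cvgM (@cvg_cst _ M _ (nbhs y) nF) (cvg_norm h).
  by rewrite y0 normr0 mulr0; apply.
apply/norm_cvg0P.
have le z : 0 <= `|cone g z| <= M * `|mass z|.
  by rewrite normr_ge0 normrM mulrC ler_wpM2r.
exact: (@squeeze_cvgr _ (nbhs y) nF R (fun=> 0) (fun z => M * `|mass z|)
  (fun z => `|cone g z|) (nearW _ le) 0 (cvg_cst 0) tc).
Qed.

End RealAnalysis.

(** * From equivariant labellings to parts with equal cone values *)

Section EqualCones.
Variables (R : realType) (p e M : nat) (I : finType).
Hypothesis p_prime : prime p.
Local Notation G := 'rV['F_p]_e.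
Local Notation m := M.+1.
Local Notation pt := {ffun 'I_m * G -> R}.
Hypothesis ME : M = (#|I| * (p ^ e).-1)%N.
Variables (c0 : I) (g_ : I -> 'rV[R]_m -> R) (B_ : I -> R).
Hypothesis g_cont : forall c, continuous (g_ c).
Hypothesis g_bounded : forall c x, `|g_ c x| <= B_ c.

Definition part (x : pt) (g : G) : 'rV[R]_m := \row_i x (i, g).
Definition height (x : pt) (c : I) (g : G) : R := cone (g_ c) (part x g).

Lemma height_pact h x c g : height (pact h x) c g = height x c (g - h).
Proof.
by congr (cone _ _); apply/rowP => i; rewrite !mxE ffunE.
Qed.

Definition spread (x : pt) (t : I * G * G) := height x t.1.1 t.1.2 - height x t.1.1 t.2.

(** The label is the upper end of a pair realizing the largest height difference over all
    coordinates. *)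
Definition good_label (x : pt) (l : I * G) :=
  exists g', forall t, spread x t <= height x l.1 l.2 - height x l.1 g'.

Lemma good_label_pact h x l : good_label x l -> good_label (pact h x) (lact h l).
Proof.
case=> g' gm; exists (g' + h) => -[[c g1] g2]; rewrite /spread !height_pact /= !addrK.
exact: (gm (c, g1 - h, g2 - h)).
Qed.

Definition max_spread (x : pt) : I * G * G :=
  [arg max_(t > ((c0, 0, 0) : I * G * G)) spread x t]%O.

Lemma good_label_max x : good_label x (max_spread x).1.
Proof.
exists (max_spread x).2 => t; rewrite /max_spread.
by case: arg_maxP => // -[[c g1] g2] _ h; apply: h.
Qed.

Definition base (x : pt) : G :=
  if [pick i | [exists g, x (i, g) != 0]] is Some i
  then odflt 0 [pick g | x (i, g) != 0] else 0.

(** In copy [i] only [tau i] can carry weight, so the group element picked there is forced and moves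
    with [x]. *)
Lemma base_pact tau h x : in_face tau x -> base (pact h x) = base x + h.
Proof.
move=> xf; have pred_eq : (fun i => [exists g, pact h x (i, g) != 0]) =1
    (fun i => [exists g, x (i, g) != 0]).
  move=> i; apply/existsP/existsP => -[g hg].
    by exists (g - h); rewrite ffunE in hg.
  by exists (g + h); rewrite ffunE /= addrK.
rewrite /base (eq_pick pred_eq); case: pickP => [i /existsP[g xg]|none]; last first.
  case: xf => _ _ /eqP; rewrite big1 ?(eq_sym 0) ?oner_eq0 // => i _.
  by apply/eqP; have /existsPn/(_ (tau i)) := negbT (none i); rewrite negbK.
have uniq_tau j k : x (j, k) != 0 -> k = tau j.
  case: xf => _ x1 _; apply: contraNeq; by move/x1 => ->.
case: pickP => [k|/(_ (g + h))]; last by rewrite ffunE /= addrK xg.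
case: pickP => [k' xk'|/(_ g)]; last by rewrite xg.
rewrite ffunE /= => xk; rewrite (uniq_tau _ _ xk') -(uniq_tau _ _ xk).
by rewrite subrK.
Qed.

(** Ties make the choice of a maximal pair non-equivariant; it is therefore made on the translate
    with base 0 and carried back. *)
Definition lam (x : pt) : I * G :=
  lact (base x) (max_spread (pact (- base x) x)).1.

Lemma lam_pact tau x h : in_face tau x -> lam (pact h x) = lact h (lam x).
Proof.
move=> xf; rewrite /lam (base_pact _ xf) -pactD opprD -addrA addNr addr0.
by rewrite -lactD addrC.
Qed.

Lemma lam_good x : good_label x (lam x).
Proof.
have := good_label_pact (base x) (good_label_max (pact (- base x) x)).
by rewrite -pactD addrN pact0.
Qed.

Definition masked (tau : 'I_m -> G) (g : G) (a : 'rV[R]_m) : 'rV[R]_m :=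
  \row_i (if tau i == g then a ord0 i else 0).

Definition weights (tau : 'I_m -> G) (x : pt) : 'rV[R]_m := \row_i x (i, tau i).

Lemma part_masked tau x g : in_face tau x -> part x g = masked tau g (weights tau x).
Proof.
case=> _ x0 _; apply/rowP => i; rewrite !mxE.
by case: eqVneq => [->//|ti]; rewrite x0 // eq_sym.
Qed.

Lemma weights_simplex tau x : in_face tau x -> simplex R M (weights tau x).
Proof.
case=> x0 _ x1; split=> [i|]; first by rewrite mxE.
by rewrite -[RHS]x1; apply: eq_bigr => i _; rewrite mxE.
Qed.

Lemma masked_continuous tau g : continuous (masked tau g).
Proof.
move=> a; apply: (@cvg_rowmx _ _ (nbhs a) _ _
   (fun i (a : 'rV[R]_m) => if tau i == g then a ord0 i else 0)
   (fun i => if tau i == g then a ord0 i else 0)) => i.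
by case: (tau i == g) => /=; [exact: coord_continuous|exact: cvg_cst].
Qed.

Definition equal_cones (a : 'rV[R]_m) (tau : 'I_m -> G) :=
  forall c g h, cone (g_ c) (masked tau g a) = cone (g_ c) (masked tau h a).

Lemma near_cones eta tau a : 0 < eta ->
  \forall a' \near a, forall c g,
    `|cone (g_ c) (masked tau g a) - cone (g_ c) (masked tau g a')| <= eta.
Proof.
move=> eta0; apply: (filter_forall (nbhs_filter a)) => c.
apply: (filter_forall (nbhs_filter a)) => g.
have cc : {for a, continuous (fun a => cone (g_ c) (masked tau g a))}.
  by apply: continuous_comp; [exact: masked_continuous|exact: cone_continuous].
move/cvgrPdist_le: cc; exact.
Qed.

Lemma not_full_near a tau : ~ equal_cones a tau ->
  exists2 U : set 'rV[R]_m, nbhs a U & forall t : seq pt,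
    {in t, forall x, in_face tau x} -> {in t, forall x, U (weights tau x)} ->
    ~~ full_column (vset (map lam t)).
Proof.
move=> ne; pose F c g := cone (g_ c) (masked tau g a).
have [c1 [g1 [g2 lt12]]] : exists c g1 g2, F c g1 < F c g2.
  apply: contrapT => h; apply: ne => c g k; apply/eqP; rewrite eq_le.
  by apply/andP; split; rewrite leNgt; apply/negP => lt; apply: h;
    [exists c, k, g|exists c, g, k].
(* The comparison below loses [eta] six times: twice in coordinate [c1], and four times in passing
   between [x] and [x'] in coordinate [c]. *)
pose eta := (F c1 g2 - F c1 g1) / 7%:R.
have eta0 : 0 < eta by rewrite divr_gt0 // subr_gt0.
exists [set a' | forall c g,
    `|cone (g_ c) (masked tau g a) - cone (g_ c) (masked tau g a')| <= eta].
  exact: near_cones.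
move=> t tf tU; apply/negP => /existsP[c /forallP fc].
have pick g : exists x, [/\ in_face tau x, good_label x (c, g) &
    forall c g, `|F c g - height x c g| <= eta].
  have := fc g; rewrite inE => /mapP[x xt ->]; exists x.
  split; [exact: tf|exact: lam_good|] => d k.
  by rewrite /height (part_masked _ (tf x xt)); apply: tU.
(* At [x] the largest spread runs from [g'] up to 0. As the column is full, [g'] labels some [x'],
   where it is the highest; so this spread is nearly 0. *)
have [x [_ [g' gm] xe]] := pick 0; have [x' [_ [g'' gm'] xe']] := pick g'.
have le1 : height x' c 0 <= height x' c g'.
  by have := gm' (c, 0, g''); rewrite /spread /= lerD2r.
have := gm (c1, g2, g1); rewrite /spread /=.
move: (xe c1 g1) (xe c1 g2) (xe c 0) (xe c g') (xe' c 0) (xe' c g') le1.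
rewrite !ler_norml => /andP[? ?] /andP[? ?] /andP[? ?] /andP[? ?] /andP[? ?] /andP[? ?] ? ?.
have : 7%:R * eta = F c1 g2 - F c1 g1 by rewrite mulrC divfK.
clearbody eta => eta7. lra.
Qed.

(** Ever smaller simplices with a full column accumulate, by compactness, at some [b]; unequal cones
    at [b] for all [tau] would exclude full columns nearby. *)
Lemma exists_equal_cones : exists a tau, simplex R M a /\ equal_cones a tau.
Proof.
apply: contrapT => none.
have mE : m = (#|I| * (p ^ e).-1).+1 by rewrite ME.
pose kap := mesh_ratio R m.
have /choice[d dP] : forall N, exists d : ('I_m -> G) * seq pt,
    [/\ {in d.2, forall x, in_face d.1 x}, small (kap ^+ N) d.2
      & full_column (vset (map lam d.2))].
  by move=> N; have [tau [t h]] := elementary_labelling p_prime mE lam_pact N; exists (tau, t).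
have dne N : exists x, x \in (d N).2.
  have [_ _ /existsP[c /forallP/(_ 0)]] := dP N.
  by rewrite inE => /mapP[x xt _]; exists x.
have [q qP] := choice dne.
pose a N := weights (d N).1 (q N).
have aS N : simplex R M (a N) by apply: weights_simplex; case: (dP N) => h _ _; apply: h.
have [b [bS bcl]] : simplex R M `&` cluster (a @ \oo) !=set0.
  by apply: simplex_compact; exists 0%N => // N _; apply: aS.
have nfull (tau : 'I_m -> G) := @not_full_near b tau
  (fun h => none (ex_intro _ b (ex_intro _ tau (conj bS h)))).
(* The selection [tau] changes with [N], but there are finitely many, so one neighbourhood of [b]
   serves them all. *)
have /choice[U UP] : forall tau : {ffun 'I_m -> G}, exists U : set 'rV[R]_m,
    nbhs b U /\ forall t : seq pt,
    {in t, forall x, in_face tau x} -> {in t, forall x, U (weights tau x)} ->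
    ~~ full_column (vset (map lam t)).
  by move=> tau; have [U ? ?] := nfull tau; exists U.
have : \forall a' \near b, forall tau, U tau a'.
  by apply: (filter_forall (nbhs_filter b)) => tau; case: (UP tau).
case/nbhs_ballP => rho /= rho0 sub.
have kap_lt1 : `|kap| < 1.
  rewrite ger0_norm ?divr_ge0 // ltr_pdivrMr ?ltr0n // mul1r ltr_nat.
  by rewrite -ltnS.
have rho20 : 0 < rho / 2 by rewrite divr_gt0.
have [N0 _ small_pow] : \forall N \near \oo, kap ^+ N <= rho / 2.
  have := cvg_expr kap_lt1; move/cvgr0Pnorm_le => /(_ (rho / 2)).
  rewrite divr_gt0 // => /(_ isT); apply: filterS => N; apply: le_trans.
  exact: ler_norm.
have [|_ [[N N0N <-]]] := bcl [set y | exists2 N, (N0 <= N)%N & a N = y]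
   (ball b (rho / 2)) _ (nbhsx_ballx b (rho / 2) rho20).
  by exists N0 => // N /= N0N; exists N.
case=> _ near_b; have [tf ts tfull] := dP N.
pose tau : {ffun 'I_m -> G} := [ffun i => (d N).1 i].
have tauE x : in_face (d N).1 x -> in_face tau x.
  case=> x0 x1 x2; split=> // [i g|]; first by rewrite ffunE; apply: x1.
  by rewrite -[RHS]x2; apply: eq_bigr => i _; rewrite ffunE.
have := (UP tau).2 (d N).2; rewrite tfull => h.
suff: ~~ true by [].
apply: h => x xt; first exact/tauE/tf.
apply: sub; split=> // i j; rewrite (ord1 i) {i}.
have -> : weights tau x = weights (d N).1 x by apply/rowP => i; rewrite !mxE ffunE.
have h1 := near_b ord0 j; have h2 := ts (q N) x (qP N) xt (j, (d N).1 j).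
have h3 := small_pow N N0N; rewrite /= in h3.
rewrite /ball /= in h1 *; rewrite !mxE in h1 *.
rewrite -[b ord0 j](subrK (q N (j, (d N).1 j))) -addrA.
apply: le_lt_trans (ler_normD _ _) _.
by rewrite [rho]splitr ltr_leD // (le_trans h2).
Qed.

End EqualCones.

(** An additional coordinate, constant 1, forces the parts to have equal mass. It is nonzero as the
    masses sum to 1, so rescaling turns equal cones into equal values of [f]. *)
Theorem topological_tverberg (R : realType) (p e M : nat) (J : finType)
    (f : J -> 'rV[R]_M.+1 -> R) :
  prime p -> M = (#|J|.+1 * (p ^ e).-1)%N ->
  (forall c, {within simplex R M, continuous (f c)}) ->
  exists x : 'rV['F_p]_e -> 'rV[R]_M.+1,
    [/\ forall g, simplex R M (x g),
        forall g h i, g != h -> x g ord0 i = 0 \/ x h ord0 i = 0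
      & forall c g h, f c (x g) = f c (x h)].
Proof.
move=> p_prime ME fc.
have ext c := simplex_extension (fc c).
have /choice[g_ /choice[B_ gB]] : forall c : option J, exists g : 'rV[R]_M.+1 -> R,
    exists B : R, [/\ forall x, simplex R M x -> g x = if c is Some c' then f c' x else 1,
                  continuous g & forall x, `|g x| <= B].
  case=> [c|]; first by have [g [B h]] := ext c; exists g, B.
  exists (fun=> 1), 1; split=> //; last by move=> x; rewrite normr1.
  exact: cst_continuous.
have gS c x : simplex R M x -> g_ c x = if c is Some c' then f c' x else 1.
  by case: (gB c) => h _ _; apply: h.
have ME' : M = (#|{: option J}| * (p ^ e).-1)%N by rewrite card_option.
have [a [tau [[a0 a1] eqc]]] := exists_equal_cones p_prime ME' None
  (fun c => let: And3 _ h _ := gB c in h) (fun c => let: And3 _ _ h := gB c in h).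
pose w g := mass (masked tau g a).
have masked_ge0 g i : 0 <= masked tau g a ord0 i by rewrite mxE; case: ifP.
have w0 g : 0 <= w g by apply: sumr_ge0.
have wsum : \sum_g w g = 1.
  rewrite /w /mass exchange_big /= -a1; apply: eq_bigr => i _.
  rewrite (bigD1 (tau i)) //= mxE eqxx big1 ?addr0 // => g gt.
  by rewrite mxE eq_sym (negbTE gt).
have xS g : w g != 0 -> simplex R M ((w g)^-1 *: masked tau g a).
  move=> wn0; split=> [i|].
    by rewrite mxE mulr_ge0 // invr_ge0.
  by under eq_bigr do rewrite mxE; rewrite -mulr_sumr mulVf.
have coneE c g : w g != 0 ->
    cone (g_ c) (masked tau g a) =
    w g * (if c is Some c' then f c' ((w g)^-1 *: masked tau g a) else 1).
  by move=> wn0; rewrite /cone -/(w g) gS //; apply: xS.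
have cone0 c g : w g = 0 -> cone (g_ c) (masked tau g a) = 0.
  by move=> wg0; rewrite /cone -/(w g) wg0 mul0r.
have weq g h : w g = w h.
  have := eqc None g h; have [wg|wg] := eqVneq (w g) 0; have [wh|wh] := eqVneq (w h) 0.
  - by rewrite wg wh.
  - by rewrite (cone0 _ _ wg) (coneE _ _ wh) wg mulr1.
  - by rewrite (cone0 _ _ wh) (coneE _ _ wg) wh mulr1.
  - by rewrite (coneE _ _ wg) (coneE _ _ wh) !mulr1.
have wn0 g : w g != 0.
  apply/eqP => wg; have /eqP := wsum; rewrite big1 ?(eq_sym 0) ?oner_eq0 // => h _.
  by rewrite (weq h g).
exists (fun g => (w g)^-1 *: masked tau g a); split=> [g|g h i gh|c g h].
- exact: xS.
- rewrite !mxE; case: (eqVneq (tau i) g) => [tg|_]; last by left; rewrite mulr0.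
  by right; rewrite tg (negbTE gh) mulr0.
- have := eqc (Some c) g h; rewrite (coneE _ _ (wn0 g)) (coneE _ _ (wn0 h)) (weq g h).
  by move/(mulfI (wn0 h)).
Qed.

(** * Dimension bounds and j-wise disjointness *)

Lemma card_draw_exists (T : finType) (B : {set T}) n : (n <= #|B|)%N ->
  exists2 S : {set T}, S \subset B & #|S| = n.
Proof.
move=> nB; have : (0 < #|[set S : {set T} | S \subset B & #|S| == n]%SET|)%N.
  by rewrite cards_draws bin_gt0.
by case/card_gt0P => S; rewrite inE => /andP[SB /eqP]; exists S.
Qed.

Section SupportSize.
Variables (R : realType) (n : nat).
Implicit Types x : 'rV[R]_n.+1.

Definition supp x : {set 'I_n.+1} := [set i | x ord0 i != 0]%SET.
Definition elem_sym k x := \sum_(S : {set 'I_n.+1} | #|S| == k) \prod_(i in S) x ord0 i.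

Lemma elem_sym_eq0 k x : (forall i, 0 <= x ord0 i) ->
  (elem_sym k x == 0) = (#|supp x| < k)%N.
Proof.
move=> x0; rewrite /elem_sym psumr_eq0; last by move=> S _; apply: prodr_ge0.
apply/allP/idP => [h|sk S _].
  rewrite ltnNge; apply/negP => /card_draw_exists[S Ss Sk].
  have := h S (mem_index_enum _); rewrite Sk eqxx /= => /prodf_eq0[i iS].
  by apply/negP; have := fintype.subsetP Ss i iS; rewrite inE.
apply/implyP => /eqP Sk; apply/prodf_eq0.
have /subsetPn[i iS ni] : ~~ (S \subset supp x).
  by apply: contraL sk => /subset_leq_card; rewrite Sk -leqNgt.
by exists i => //; move: ni; rewrite inE negbK.
Qed.

Lemma elem_sym_continuous k : continuous (elem_sym k).
Proof.
move=> x; apply: (@cvg_bigsum _ _ (nbhs x)) => S.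
by apply: (@cvg_bigprod _ _ (nbhs x)) => i; apply: coord_continuous.
Qed.

End SupportSize.

Section Pushforward.
Variables (R : realType) (M N : nat) (pi : 'I_M.+1 -> 'I_N.+1).

Definition push (x : 'rV[R]_M.+1) : 'rV[R]_N.+1 :=
  \row_u \sum_(v | pi v == u) x ord0 v.

Lemma push_continuous : continuous push.
Proof.
move=> x; apply: (@cvg_rowmx _ _ (nbhs x) _ _
  (fun u (x : 'rV[R]_M.+1) => \sum_(v | pi v == u) x ord0 v)
  (fun u => \sum_(v | pi v == u) x ord0 v)) => u.
by apply: (@cvg_bigsum _ _ (nbhs x)) => i; apply: coord_continuous.
Qed.

Lemma push_face x : simplex R M x -> face_pts (pi @: supp x)%SET (push x).
Proof.
case=> x0 x1; split; first split=> [u|].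
- by rewrite mxE sumr_ge0.
- rewrite -[RHS]x1 (partition_big pi xpredT) //=.
  by apply: eq_bigr => u _; rewrite mxE.
move=> u nu; rewrite mxE big1 // => v /eqP vu; apply/eqP.
apply: contraNT nu => xv; apply/imsetP; exists v => //; by rewrite inE.
Qed.

End Pushforward.

Lemma card_disjoint_family (T G : finType) (S : G -> {set T}) :
  (forall g h x, x \in S g -> x \in S h -> g = h) -> (\sum_g #|S g| <= #|T|)%N.
Proof.
move=> dS; have -> : (\sum_g #|S g| = \sum_x #|[set g | x \in S g]%SET|)%N.
  rewrite (eq_bigr (fun g => \sum_(x | x \in S g) 1)%N); last by move=> g _; rewrite sum1_card.
  rewrite (exchange_big_dep xpredT) //=; apply: eq_bigr => x _.
  by rewrite sum1_card; apply: eq_card => g; rewrite inE.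
rewrite -[X in (_ <= X)%N]sum1_card; apply: leq_sum => x _.
apply/card_le1_eqP => g h; rewrite !inE => xg xh; by rewrite (dS _ _ _ xg xh).
Qed.

Theorem theorem7p3 (R : realType) (r k N j d : nat) :
  prime_power r -> (0 < k)%N -> (0 < N)%N -> (0 < j)%N -> (0 < d)%N ->
  ((k.+1) * r + r - 1 <= N.+1 * (j - 1))%N ->
  ((r - 1) * d.+1 + 1 <= r * k.+1)%N ->
  forall f : 'rV[R]_(N.+1) -> 'rV[R]_d,
  {within simplex R N, continuous f} ->
  exists sigma : 'I_r -> {set 'I_(N.+1)},
    [/\ (forall t, sigma t != finset.set0),
        (forall t, (#|sigma t| <= k.+1)%N),
        jwise_disjoint j sigma
      & exists y : 'rV[R]_d, forall t, exists2 x, @face_pts R N (sigma t) x & f x = y].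
Proof.
case=> p [e [p_prime e0 rE]] _ _ _ _ hN hk f fc.
have r2 : (1 < r)%N by rewrite rE -(exp1n e) ltn_exp2r ?prime_gt1.
(* [d] coordinates of [f], one for the elementary symmetric polynomial and one for the masses. *)
pose M := (d.+2 * r.-1)%N.
have MN : (M.+1 <= N.+1 * (j - 1))%N.
  apply: leq_trans hN; rewrite /M; nia.
have j1 : (0 < j - 1)%N by case: (j - 1)%N MN => //; rewrite muln0.
have piP (v : 'I_M.+1) : (v %/ (j - 1) < N.+1)%N.
  by rewrite ltn_divLR //; apply: leq_trans MN.
(* Blocks of [j - 1] consecutive vertices are the copies of one vertex. *)
pose pi (v : 'I_M.+1) : 'I_N.+1 := Ordinal (piP v).
have ext (c : 'I_d) : exists g : 'rV[R]_N.+1 -> R,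
    (forall x, simplex R N x -> g x = f x ord0 c) /\ continuous g.
  have [|g [B [h1 h2 _]]] := @simplex_extension R N (fun x => f x ord0 c); last by exists g.
  move=> x; apply: (@continuous_comp (subspace (simplex R N)) _ _ f
    (fun y : 'rV[R]_d => y ord0 c)); [exact: fc|exact: coord_continuous].
have [g_ gP] := choice ext.
pose F (c : option 'I_d) (x : 'rV[R]_M.+1) :=
  if c is Some c' then g_ c' (push pi x) else elem_sym k.+2 x.
have Fc c : continuous (F c).
  case: c => [c|]; last exact: elem_sym_continuous.
  by move=> x; apply: continuous_comp; [exact: push_continuous|exact: (gP c).2].
have [||x [xS xd xF]] := @topological_tverberg R p e M _ F p_prime.
- by rewrite card_option card_ord -rE.
- by move=> c; apply: continuous_subspaceT.
have dS g h i : i \in supp (x g) -> i \in supp (x h) -> g = h.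
  rewrite !inE => xg xh; apply/eqP/negPn/negP => gh.
  by case: (xd g h i gh) => x0; rewrite x0 eqxx in xg xh.
have cardG : #|{: 'rV['F_p]_e}| = r by rewrite card_elementary.
(* If all [r] disjoint supports had [k + 2] vertices, they would exceed the [M + 1] available. So
   the symmetric polynomial vanishes at one point, hence at all. *)
have small_supp g : (#|supp (x g)| < k.+2)%N.
  have [h hk'] : exists h, (#|supp (x h)| < k.+2)%N.
    apply: contrapT => none.
    have := card_disjoint_family dS; apply/negP; rewrite -ltnNge card_ord.
    apply: (@leq_trans (\sum_(g : 'rV['F_p]_e) k.+2)); last first.
      apply: leq_sum => h _; rewrite leqNgt; apply/negP => hh; apply: none; by exists h.
    rewrite sum_nat_const cardG /M; nia.
  rewrite -(elem_sym_eq0 _ (xS g).1) -[elem_sym _ _]/(F None (x g)) (xF None g h).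
  by rewrite /F (elem_sym_eq0 _ (xS h).1).
pose G (t : 'I_r) : 'rV['F_p]_e := enum_val (cast_ord (esym cardG) t).
have G_inj : injective G by move=> s t /enum_val_inj/cast_ord_inj.
exists (fun t => (pi @: supp (x (G t)))%SET); split=> [t|t|T Tj v|].
- rewrite imset_eq0; apply/eqP => s0; have [_ /eqP] := xS (G t).
  rewrite big1 ?(eq_sym 0) ?oner_eq0 // => i _; apply/eqP/negPn/negP => xi.
  by have : i \in supp (x (G t)) by [rewrite inE]; rewrite s0 inE.
- by apply: leq_trans (leq_imset_card _ _) _; rewrite -ltnS.
- apply: contrapT => none.
  have pre (t : 'I_r) : exists w, t \in T -> w \in supp (x (G t)) /\ pi w = v.
    have [tT|] := boolP (t \in T); last by exists ord0.
    have [|nv] := boolP (v \in (pi @: supp (x (G t)))%SET).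
      by case/imsetP => w ws ->; exists w.
    by case: none; exists t.
  have [w wP] := choice pre.
  have w_inj : {in T &, injective w}.
    move=> s t sT tT wst; apply: G_inj; apply: (dS _ _ (w s)).
      exact: (wP s sT).1.
    by rewrite wst (wP t tT).1.
  (* Faces sharing [v] use distinct copies of [v]; elements of a fibre of [pi] are told apart by
     their remainder modulo [j - 1]. *)
  have fib : (#|[set u : 'I_M.+1 | pi u == v]%SET| <= j - 1)%N.
    pose rem (u : 'I_M.+1) : 'I_(j - 1) := Ordinal (ltn_pmod u j1).
    rewrite -[X in (_ <= X)%N]card_ord -(card_in_imset (f := rem)); first exact: max_card.
    move=> u u'; rewrite !inE => /eqP uv /eqP u'v /(congr1 val) /= e1; apply: val_inj => /=.
    rewrite (divn_eq u (j - 1)) e1 [RHS](divn_eq u' (j - 1)).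
    by congr (_ * _ + _)%N; have := congr1 val (etrans uv (esym u'v)).
  have : (j <= j - 1)%N.
    rewrite -{1}Tj -(card_in_imset w_inj); apply: leq_trans fib.
    by apply/subset_leq_card/fintype.subsetP => _ /imsetP[t tT ->]; rewrite inE (wP t tT).2.
  by move: j1; lia.
exists (f (push pi (x 0))) => t; exists (push pi (x (G t))); first exact: push_face.
apply/rowP => c; have := xF (Some c) (G t) 0; rewrite /F.
by rewrite !(gP c).1 //; apply: (push_face pi (xS _)).1.
Qed.
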